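(* Let $H$ be a colour Hopf algebra, $A$ a colour-commutative graded $H$-comodule colour algebra and $B=A^{coH}$. Assume that $B$ is a colour division ring (for example, if $A$ is colour $H$-simple), that there is a graded $H$-colinear map $\theta:H\to A$ which is a homomorphism of colour algebras, and that the bicharacter is symmetric. Regard $B$ as a graded left $A$-module via $a\rightharpoonup b=p_A(ab)$ for $a\in A$, $b\in B$, where $p_A(x)=\theta(\mathcal S_H(x_{(-1)}))x_{(0)}$ for $x\in A$. Then $$\mathrm{gr.gldim}\,A=\mathrm{gr.pdim}_A B=\mathrm{pdim}_A B,$$ where $\mathrm{gr.gldim}\,A$ and $\mathrm{gr.pdim}_A$ denote respectively the graded global dimension of $A$ and the graded projective dimension over $A$, and $\mathrm{pdim}_A$ is the projective dimension over $A$.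
   Context: $\Bbbk$ is a field and $G$ is a multiplicative abelian group with identity $e$ and a bicharacter $(\cdot/\cdot):G\times G\to\Bbbk^{\times}$, i.e. $(g/g'g'')=(g/g')(g/g'')$ and $(gg'/g'')=(g/g'')(g'/g'')$. The bicharacter is symmetric if $(g/g')(g'/g)=1$ for all $g,g'$. ''Graded'' means $G$-graded; $|m|$ is the degree of a homogeneous element $m$; formulas are written for homogeneous elements and extended linearly. A graded map $f:M\to N$ is a $\Bbbk$-linear map with $f(M_g)\subseteq N_g$ for all $g$. $\otimes=\otimes_{\Bbbk}$, graded by $(M\otimes N)_g=\bigoplus_{g'g''=g}M_{g'}\otimes N_{g''}$; $\Bbbk$ is in degree $e$. A colour algebra is a $G$-graded associative unital $\Bbbk$-algebra; it is colour-commutative if $ab=(|a|/|b|)ba$ for all homogeneous $a,b$; a homomorphism of colour algebras is a graded map that is a unital $\Bbbk$-algebra homomorphism. A colour division ring is a colour algebra in which every non-zero homogeneous element is invertible. A colour Hopf algebra $H$ is a colour algebra which is also a (coassociative, counital) coalgebra with graded maps $\Delta_H$, $\varepsilon_H$ (write $\Delta_H(h)=h_1\otimes h_2$ with homogeneous components), such that $\varepsilon_H$ is a unital algebra map, $\Delta_H(1_H)=1_H\otimes 1_H$, $\Delta_H(hh')=(|h_2|/|h'_1|)\,h_1h'_1\otimes h_2h'_2$, and with a graded map $\mathcal S_H:H\to H$ (antipode) satisfying $h_1\mathcal S_H(h_2)=\varepsilon_H(h)1_H=\mathcal S_H(h_1)h_2$. A graded $H$-comodule is a graded vector space $M$ with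 a graded map $\chi_M:M\to H\otimes M$, $\chi_M(m)=m_{(-1)}\otimes m_{(0)}$, which is coassociative and counital (left comodule). $H$ is a graded $H$-comodule via $\Delta_H$. A graded $H$-colinear map is a graded map $f$ with $f(m)_{(-1)}\otimes f(m)_{(0)}=m_{(-1)}\otimes f(m_{(0)})$. Coinvariants: $M^{coH}=\{m\in M:\chi_M(m)=1_H\otimes m\}$. A graded $H$-comodule colour algebra is a colour algebra $A$ that is a graded $H$-comodule with $\chi_A(1_A)=1_H\otimes 1_A$ and $\chi_A(aa')=(|a_{(0)}|/|a'_{(-1)}|)\,a_{(-1)}a'_{(-1)}\otimes a_{(0)}a'_{(0)}$; $B=A^{coH}$ is a graded subalgebra. $A$ is colour $H$-simple if its only graded two-sided ideals $I$ with $\chi_A(I)\subseteq H\otimes I$ are $(0)$ and $A$. Under the hypotheses of the claim, $p_A(A)=A^{coH}=B$ and $\rightharpoonup$ makes $B$ a graded left $A$-module. Graded left $A$-modules ($A_gM_{g'}\subseteq M_{gg'}$) with graded $A$-linear maps form a category; $\mathrm{gr.pdim}_A M$ is the projective dimension of $M$ in this category, $\mathrm{gr.gldim}\,A$ is the supremum of $\mathrm{gr.pdim}_AM$ over all graded left $A$-modules $M$, and $\mathrm{pdim}_A$ is the projective dimension in the category of all (ungraded) left $A$-modules. *)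

(* Defs.v *)
From HB Require Import structures.
From mathcomp Require Import all_boot all_order all_algebra.
From mathcomp Require Import boolp.

Set Implicit Arguments.
Unset Strict Implicit.
Unset Printing Implicit Defensive.

Import GRing.Theory.

Local Open Scope ring_scope.
Local Open Scope quotient_scope.

(* The tensor product of two vector spaces: formal sums of pairs, i.e. finite
   sequences, modulo the relations of bilinearity. No coefficients are needed,
   since a scalar can be absorbed in either component. *)

Inductive tens_eqv (k : fieldType) (M N : lmodType k) :
    seq (M * N) -> seq (M * N) -> Prop :=
| TensRefl s : tens_eqv s s
| TensSym s t : tens_eqv s t -> tens_eqv t s
| TensTrans s t u : tens_eqv s t -> tens_eqv t u -> tens_eqv s u
| TensCatC s t : tens_eqv (s ++ t) (t ++ s)
| TensCat s s' t : tens_eqv s s' -> tens_eqv (s ++ t) (s' ++ t)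
| TensAddl m m' n : tens_eqv [:: (m + m', n)] [:: (m, n); (m', n)]
| TensAddr m n n' : tens_eqv [:: (m, n + n')] [:: (m, n); (m, n')]
| TensScale a m n : tens_eqv [:: (a *: m, n)] [:: (m, a *: n)]
| TensZero n : tens_eqv [:: (0, n)] [::].

Section Tensor.
Variables (k : fieldType) (M N : lmodType k).
Implicit Types (s t u : seq (M * N)) (a b : k).

Definition tens_rel : rel (seq (M * N)) := fun s t => `[< tens_eqv s t >].

Lemma tens_rel_equiv : equiv_class_of tens_rel.
Proof.
split=> [s|s t|t s u].
- by apply/asboolP; apply: TensRefl.
- by apply/asboolP/asboolP; apply: TensSym.
- by move=> /asboolP st /asboolP tu; apply/asboolP; apply: TensTrans st tu.
Qed.

Canonical tens_equiv := EquivRelPack tens_rel_equiv.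
Canonical tens_encModRel := defaultEncModRel tens_rel.

Definition tensor := {eq_quot tens_rel}.

HB.instance Definition _ : EqQuotient _ tens_rel tensor :=
  EqQuotient.on tensor.
HB.instance Definition _ := Choice.on tensor.

Lemma tens_piP s t : tens_eqv s t <-> \pi_tensor s = \pi_tensor t.
Proof.
split=> [st|/eqmodP /asboolP //].
by apply/eqmodP; apply/asboolP.
Qed.

Lemma tensW (P : tensor -> Prop) : (forall s, P (\pi_tensor s)) -> forall x, P x.
Proof. by move=> Pp x; rewrite -[x]reprK. Qed.

Lemma tens_repr s : tens_eqv (repr (\pi_tensor s)) s.
Proof. by apply: (tens_piP _ _).2; rewrite reprK. Qed.

Definition tens_scale_seq a s := [seq (a *: p.1, p.2) | p <- s].

Definition tens_zero : tensor := \pi_tensor [::].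
Definition tens_add (x y : tensor) : tensor := \pi_tensor (repr x ++ repr y).
Definition tens_scale a (x : tensor) : tensor :=
  \pi_tensor (tens_scale_seq a (repr x)).
Definition tens_opp : tensor -> tensor := tens_scale (- 1).

Lemma tens_cat s s' t t' :
  tens_eqv s s' -> tens_eqv t t' -> tens_eqv (s ++ t) (s' ++ t').
Proof.
move=> ss' tt'; apply: (TensTrans (TensCat t ss')).
apply: (TensTrans (TensCatC _ _)); apply: (TensTrans (TensCat s' tt')).
exact: TensCatC.
Qed.

Lemma tens_scale_eqv a s t :
  tens_eqv s t -> tens_eqv (tens_scale_seq a s) (tens_scale_seq a t).
Proof.
rewrite /tens_scale_seq.
elim=> {s t} [s|s t _|s t u _ + _|s t|s s' t _|m m' n|m n n'|b m n|n] //=.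
- exact: TensRefl.
- exact: TensSym.
- exact: TensTrans.
- by rewrite !map_cat; apply: TensCatC.
- by rewrite !map_cat; apply: TensCat.
- by rewrite scalerDr; apply: TensAddl.
- exact: TensAddr.
- by rewrite scalerA mulrC -scalerA; apply: TensScale.
- by rewrite scaler0; apply: TensZero.
Qed.

Lemma tens_pi_add s t :
  tens_add (\pi_tensor s) (\pi_tensor t) = \pi_tensor (s ++ t).
Proof.
rewrite /tens_add; apply: (tens_piP _ _).1.
by apply: tens_cat; apply: tens_repr.
Qed.

Lemma tens_pi_scale a s :
  tens_scale a (\pi_tensor s) = \pi_tensor (tens_scale_seq a s).
Proof.
rewrite /tens_scale; apply: (tens_piP _ _).1.
exact/tens_scale_eqv/tens_repr.
Qed.

Lemma tens_addA : associative tens_add.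
Proof.
elim/tensW=> s; elim/tensW=> t; elim/tensW=> u.
by rewrite !tens_pi_add catA.
Qed.

Lemma tens_addC : commutative tens_add.
Proof.
elim/tensW=> s; elim/tensW=> t; rewrite !tens_pi_add.
by apply: (tens_piP _ _).1; apply: TensCatC.
Qed.

Lemma tens_add0 : left_id tens_zero tens_add.
Proof. by elim/tensW=> s; rewrite tens_pi_add. Qed.

Lemma tens_scale0_eqv s : tens_eqv (tens_scale_seq 0 s) [::].
Proof.
elim: s => [|[m n] s IHs] /=; first exact: TensRefl.
rewrite scale0r -[_ :: _]/([:: (0, n)] ++ tens_scale_seq 0 s).
by apply: (tens_cat (TensZero _ _) IHs).
Qed.

Lemma tens_scaleDl_eqv a b s :
  tens_eqv (tens_scale_seq (a + b) s) (tens_scale_seq a s ++ tens_scale_seq b s).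
Proof.
elim: s => [|[m n] s IHs] /=; first exact: TensRefl.
rewrite scalerDl -[_ :: _]/([:: _] ++ tens_scale_seq (a + b) s).
apply: (TensTrans (tens_cat (TensAddl _ _ _) IHs)) => /=.
apply: (@tens_cat [:: _] [:: _]); first exact: TensRefl.
rewrite -cat1s -(cat1s _ (tens_scale_seq b s)) !catA.
by apply: tens_cat; [apply: TensCatC | apply: TensRefl].
Qed.

Lemma tens_scaleA a b x : tens_scale a (tens_scale b x) = tens_scale (a * b) x.
Proof.
elim/tensW: x => s; rewrite !tens_pi_scale /tens_scale_seq -map_comp.
by congr \pi_tensor; apply: eq_map => p /=; rewrite scalerA.
Qed.

Lemma tens_scale1 : left_id 1 tens_scale.
Proof.
elim/tensW=> s; rewrite tens_pi_scale; congr \pi_tensor.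
by rewrite -[RHS]map_id; apply: eq_map => -[m n] /=; rewrite scale1r.
Qed.

Lemma tens_scaleDr : right_distributive tens_scale tens_add.
Proof.
move=> a; elim/tensW=> s; elim/tensW=> t.
by rewrite !(tens_pi_add, tens_pi_scale) /tens_scale_seq map_cat.
Qed.

Lemma tens_scaleDl x :
  {morph tens_scale^~ x : a b / a + b >-> tens_add a b}.
Proof.
move=> a b; elim/tensW: x => s; rewrite !tens_pi_scale tens_pi_add.
by apply: (tens_piP _ _).1; apply: tens_scaleDl_eqv.
Qed.

Lemma tens_addN : left_inverse tens_zero tens_opp tens_add.
Proof.
move=> x; rewrite -[X in tens_add _ X]tens_scale1 -tens_scaleDl addNr.
elim/tensW: x => s; rewrite tens_pi_scale.
by apply: (tens_piP _ _).1; apply: tens_scale0_eqv.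
Qed.

HB.instance Definition _ :=
  GRing.isZmodule.Build tensor tens_addA tens_addC tens_add0 tens_addN.
HB.instance Definition _ := GRing.Zmodule_isLmodule.Build k tensor
  tens_scaleA tens_scale1 tens_scaleDr tens_scaleDl.

Definition tens (m : M) (n : N) : tensor := \pi_tensor [:: (m, n)].

Lemma tens_pi_sum s : \pi_tensor s = \sum_(p <- s) tens p.1 p.2.
Proof.
elim: s => [|[m n] s IHs]; first by rewrite big_nil.
by rewrite big_cons -IHs -cat1s -tens_pi_add.
Qed.

(* The linear map on the tensor product induced by f; it is meaningful when f
   is bilinear, see tens_liftE and tens_lift_linear. *)
Definition tens_lift (P : zmodType) (f : M -> N -> P) (x : tensor) : P :=
  \sum_(p <- repr x) f p.1 p.2.

Section Lift.
Variables (P : lmodType k) (f : M -> N -> P).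
Hypothesis f_linl : forall n, linear (f^~ n).
Hypothesis f_linr : forall m, linear (f m).

Lemma tens_lift_eqv s t : tens_eqv s t ->
  \sum_(p <- s) f p.1 p.2 = \sum_(p <- t) f p.1 p.2.
Proof.
have fDl m m' n : f (m + m') n = f m n + f m' n.
  by have := f_linl n 1 m m'; rewrite /= !scale1r.
have fDr m n n' : f m (n + n') = f m n + f m n'.
  by have := f_linr m 1 n n'; rewrite !scale1r.
have f0l n : f 0 n = 0 by apply: (addIr (f 0 n)); rewrite -fDl !add0r.
have f0r m : f m 0 = 0 by apply: (addIr (f m 0)); rewrite -fDr !add0r.
elim=> {s t} [s|s t _ ->|s t u _ -> _ ->|s t|s s' t _ IH|m m' n|m n n'|a m n|n]
  //; rewrite ?big_cat ?big_cons ?big_nil /= ?addr0 //.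
- by rewrite addrC.
- by rewrite IH.
- have := f_linl n a m 0; have := f_linr m a n 0.
  by rewrite /= !addr0 f0l f0r !addr0 => -> ->.
Qed.

Lemma tens_liftE m n : tens_lift f (tens m n) = f m n.
Proof. by rewrite /tens_lift (tens_lift_eqv (tens_repr _)) big_seq1. Qed.

Lemma tens_lift_linear : linear (tens_lift f).
Proof.
move=> a; elim/tensW=> s; elim/tensW=> t.
rewrite -[a *: _]/(tens_scale _ _) -[_ + _]/(tens_add _ _).
rewrite tens_pi_scale tens_pi_add /tens_lift.
rewrite !(tens_lift_eqv (tens_repr _)) big_cat /= big_map scaler_sumr.
congr (_ + _); apply: eq_bigr => -[m n] _ /=.
have f0l : f 0 n = 0.
  apply: (addIr (f 0 n)); rewrite add0r -[X in X + _]scale1r.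
  by have := f_linl n 1 0 0; rewrite /= scale1r add0r => <-.
by have := f_linl n a m 0; rewrite /= f0l !addr0.
Qed.

End Lift.

End Tensor.

Definition tens_map (k : fieldType) (M N M' N' : lmodType k)
    (f : M -> M') (g : N -> N') : tensor M N -> tensor M' N' :=
  tens_lift (fun m n => tens (f m) (g n)).

Definition tens_assoc (k : fieldType) (L M N : lmodType k) :
    tensor (tensor L M) N -> tensor L (tensor M N) :=
  tens_lift (fun x n => tens_lift (fun l m => tens l (tens m n)) x).

(* The grading group G is written additively: the identity e is 0 and the
   product gg' is g + g'. *)

Record bicharacter (G : zmodType) (k : fieldType) := Bicharacter {
  bich :> G -> G -> k;
  bich_neq0 : forall g g', bich g g' != 0;
  bichDl : forall g g' h, bich (g + g') h = bich g h * bich g' h;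
  bichDr : forall g h h', bich g (h + h') = bich g h * bich g h'
}.

Definition symmetric_bicharacter (G : zmodType) (k : fieldType)
    (chi : bicharacter G k) : Prop :=
  forall g g', chi g g' * chi g' g = 1.

(* V is the internal direct sum of the subgroups D g. *)
Definition is_grading (G : zmodType) (V : zmodType) (D : G -> V -> Prop) : Prop :=
  [/\ forall g, D g 0,
      forall g v w, D g v -> D g w -> D g (v - w),
      forall v, exists (s : seq G) (f : G -> V),
        [/\ uniq s, forall g, D g (f g) & v = \sum_(g <- s) f g]
    & forall (s : seq G) (f : G -> V), uniq s -> (forall g, D g (f g)) ->
        \sum_(g <- s) f g = 0 -> forall g, g \in s -> f g = 0].

Definition is_graded_space (G : zmodType) (k : fieldType) (V : lmodType k)
    (D : G -> V -> Prop) : Prop :=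
  is_grading D /\ forall g a v, D g v -> D g (a *: v).

Definition graded_map (G : Type) (M N : Type)
    (DM : G -> M -> Prop) (DN : G -> N -> Prop) (f : M -> N) : Prop :=
  forall g m, DM g m -> DN g (f m).

Definition trivial_deg (G : zmodType) (k : fieldType) (g : G) (a : k) : Prop :=
  g != 0 -> a = 0.

Section GradedTensor.
Variables (G : zmodType) (k : fieldType) (M N : lmodType k).
Variables (DM : G -> M -> Prop) (DN : G -> N -> Prop).

(* s lists the terms of an expression of x as a sum of tensors m (x) n of
   homogeneous elements; a term carries the degrees of m and n. *)
Definition homogeneous_sum (s : seq ((G * G) * (M * N))) (x : tensor M N) : Prop :=
  (forall p, p \in s -> DM p.1.1 p.2.1 /\ DN p.1.2 p.2.2) /\
  x = \sum_(p <- s) tens p.2.1 p.2.2.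

Lemma homogeneous_sum_exists (x : tensor M N) :
  is_grading DM -> is_grading DN -> exists s, homogeneous_sum s x.
Proof.
move=> [_ _ DMsum _] [_ _ DNsum _]; elim/tensW: x => s.
have tensDl (n : N) : {morph (fun m : M => tens m n) : m m' / m + m'}.
  move=> m m'; rewrite /tens -[RHS]/(tens_add _ _) tens_pi_add.
  by apply: (tens_piP _ _).1; apply: TensAddl.
have tensDr (m : M) : {morph @tens k M N m : n n' / n + n'}.
  move=> n n'; rewrite /tens -[RHS]/(tens_add _ _) tens_pi_add.
  by apply: (tens_piP _ _).1; apply: TensAddr.
have tens0l (n : N) : tens (0 : M) n = 0.
  by apply: (tens_piP _ _).1; apply: TensZero.
have tens0r (m : M) : tens m (0 : N) = 0.
  by apply: (addIr (tens m 0)); rewrite -tensDr !add0r.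
rewrite tens_pi_sum; elim: s => [|[m n] s [t [tP xE]]].
  by exists [::]; split=> //; rewrite !big_nil.
have [gs [f [_ fD mE]]] := DMsum m; have [gs' [f' [_ fD' nE]]] := DNsum n.
exists ([seq ((g, g'), (f g, f' g')) | g <- gs, g' <- gs'] ++ t); split.
  move=> p; rewrite mem_cat => /orP[|/tP //].
  by case/allpairsP=> -[g g'] [_ _ ->] /=; split.
rewrite big_cons big_cat /= -xE big_allpairs_dep /=; congr (_ + _).
rewrite mE (big_morph _ (tensDl n) (tens0l n)); apply: eq_bigr => g _.
by rewrite nE (big_morph _ (tensDr (f g)) (tens0r (f g))).
Qed.

Definition tens_deg (g : G) (x : tensor M N) : Prop :=
  exists2 s, homogeneous_sum s x & forall p, p \in s -> p.1.1 + p.1.2 = g.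

End GradedTensor.

Record colourAlgebra (G : zmodType) (k : fieldType) := ColourAlgebra {
  calg :> algType k;
  cdeg : G -> calg -> Prop;
  cdeg_graded : is_graded_space cdeg;
  cdeg1 : cdeg 0 1;
  cdegM : forall g g' a b, cdeg g a -> cdeg g' b -> cdeg (g + g') (a * b)
}.

Definition colour_commutative (G : zmodType) (k : fieldType)
    (chi : bicharacter G k) (A : colourAlgebra G k) : Prop :=
  forall g g' (a b : A), cdeg g a -> cdeg g' b -> a * b = chi g g' *: (b * a).

(* d (x y) = (|x_2| / |y_1|) x_1 y_1 (x) x_2 y_2, where x_1 (x) x_2 and
   y_1 (x) y_2 stand for d x and d y. The right-hand side is independent of the
   choice of the homogeneous expressions of d x and d y, and such expressions
   always exist by homogeneous_sum_exists. *)
Definition colour_multiplicative (G : zmodType) (k : fieldType)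
    (chi : bicharacter G k) (H A : colourAlgebra G k)
    (d : A -> tensor H A) : Prop :=
  forall (x y : A) s t,
    homogeneous_sum (@cdeg _ _ H) (@cdeg _ _ A) s (d x) ->
    homogeneous_sum (@cdeg _ _ H) (@cdeg _ _ A) t (d y) ->
    d (x * y) = \sum_(p <- s) \sum_(q <- t)
      chi p.1.2 q.1.1 *: tens (p.2.1 * q.2.1) (p.2.2 * q.2.2).

Record colourHopfAlgebra (G : zmodType) (k : fieldType)
    (chi : bicharacter G k) := ColourHopfAlgebra {
  hopf_alg :> colourAlgebra G k;
  comult : {linear hopf_alg -> tensor hopf_alg hopf_alg};
  counit : {linear hopf_alg -> k^o};
  antipode : {linear hopf_alg -> hopf_alg};
  comult_graded : graded_map (@cdeg _ _ hopf_alg)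
    (tens_deg (@cdeg _ _ hopf_alg) (@cdeg _ _ hopf_alg)) comult;
  counit_graded : graded_map (@cdeg _ _ hopf_alg) (@trivial_deg G k) counit;
  antipode_graded :
    graded_map (@cdeg _ _ hopf_alg) (@cdeg _ _ hopf_alg) antipode;
  comultA : forall h, tens_assoc (tens_map comult id (comult h)) =
                      tens_map id comult (comult h);
  counitl : forall h, tens_lift (fun x y => counit x *: y) (comult h) = h;
  counitr : forall h, tens_lift (fun x y => counit y *: x) (comult h) = h;
  counit1 : counit 1 = 1;
  counitM : forall h h', counit (h * h') = counit h * counit h';
  comult1 : comult 1 = tens 1 1;
  comultM : colour_multiplicative chi comult;
  antipoder : forall h,
    tens_lift (fun x y => x * antipode y) (comult h) = (counit h)%:A;
  antipodel : forall h,
    tens_lift (fun x y => antipode x * y) (comult h) = (counit h)%:A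
}.

Definition is_graded_comodule (G : zmodType) (k : fieldType)
    (chi : bicharacter G k) (H : colourHopfAlgebra chi)
    (M : lmodType k) (DM : G -> M -> Prop)
    (coact : {linear M -> tensor H M}) : Prop :=
  [/\ is_graded_space DM,
      graded_map DM (tens_deg (@cdeg _ _ H) DM) coact,
      forall m, tens_assoc (tens_map (comult H) id (coact m)) =
                tens_map id coact (coact m)
    & forall m, tens_lift (fun (h : H) (m' : M) => counit H h *: m') (coact m) = m].

Record comoduleColourAlgebra (G : zmodType) (k : fieldType)
    (chi : bicharacter G k) (H : colourHopfAlgebra chi) :=
  ComoduleColourAlgebra {
  coalg :> colourAlgebra G k;
  coact : {linear coalg -> tensor H coalg};
  coactP : is_graded_comodule (@cdeg _ _ coalg) coact;
  coact1 : coact 1 = tens 1 1;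
  coactM : colour_multiplicative chi coact
}.

Section ComoduleAlgebra.
Variables (G : zmodType) (k : fieldType) (chi : bicharacter G k).
Variables (H : colourHopfAlgebra chi) (A : comoduleColourAlgebra H).

Definition coinvariant (a : A) : Prop := coact A a = tens 1 a.

(* H is a comodule over itself by its comultiplication. *)
Definition colinear_from_hopf (f : H -> A) : Prop :=
  forall h, coact A (f h) = tens_map id f (comult H h).

(* The homogeneous components of B = A^coH are the intersections of B with
   those of A; the inverse is required to lie in B. *)
Definition coinvariants_division_ring : Prop :=
  forall g (b : A), coinvariant b -> cdeg g b -> b != 0 ->
    exists b' : A, [/\ coinvariant b', b * b' = 1 & b' * b = 1].

Record is_graded_costable_ideal (I : A -> Prop) : Prop := {
  ideal0 : I 0;
  idealB : forall x y, I x -> I y -> I (x - y);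
  ideal_mull : forall a x, I x -> I (a * x);
  ideal_mulr : forall a x, I x -> I (x * a);
  ideal_graded : forall x, I x -> exists (s : seq G) (f : G -> A),
    [/\ forall g, cdeg g (f g), forall g, I (f g) & x = \sum_(g <- s) f g];
  ideal_costable : forall x, I x -> exists2 s : seq (H * A),
    (forall p, p \in s -> I p.2) & coact A x = \sum_(p <- s) tens p.1 p.2
}.

Definition colour_simple : Prop :=
  forall I : A -> Prop, is_graded_costable_ideal I ->
    (forall x, I x -> x = 0) \/ (forall x, I x).

Definition coinv_proj (theta : H -> A) (x : A) : A :=
  tens_lift (fun (h : H) (a : A) => theta (antipode H h) * a) (coact A x).

End ComoduleAlgebra.

(* The components are automatically k-subspaces, since k1 lies in A_e. *)
Record gradedModule (G : zmodType) (k : fieldType) (A : colourAlgebra G k) :=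
  GradedModule {
  gmod :> lmodType A;
  mdeg : G -> gmod -> Prop;
  mdeg_grading : is_grading mdeg;
  mdegZ : forall g g' (a : A) (m : gmod),
    cdeg g a -> mdeg g' m -> mdeg (g + g') (a *: m)
}.

Section HomologicalDimensions.
Variables (G : zmodType) (k : fieldType) (A : colourAlgebra G k).

Definition surj (X Y : Type) (f : X -> Y) : Prop := forall y, exists x, f x = y.

Definition projective (P : lmodType A) : Prop :=
  forall (M N : lmodType A) (f : {linear M -> N}) (g : {linear P -> N}),
    surj f -> exists h : {linear P -> M}, forall x, f (h x) = g x.

Definition graded_projective (P : gradedModule A) : Prop :=
  forall (M N : gradedModule A) (f : {linear M -> N}) (g : {linear P -> N}),
    graded_map (@mdeg _ _ _ M) (@mdeg _ _ _ N) f ->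
    graded_map (@mdeg _ _ _ P) (@mdeg _ _ _ N) g ->
    surj f ->
    exists h : {linear P -> M},
      graded_map (@mdeg _ _ _ P) (@mdeg _ _ _ M) h /\ forall x, f (h x) = g x.

(* Exactness of ... -> P 1 -> P 0 -> M -> 0, with P i = 0 for i > n. *)
Definition exact_resolution (n : nat) (P : nat -> lmodType A) (M : lmodType A)
    (d : forall i, {linear P i.+1 -> P i}) (eps : {linear P 0%N -> M}) : Prop :=
  [/\ surj eps,
      forall x, eps x = 0 <-> exists y, d 0%N y = x,
      forall i x, d i x = 0 <-> exists y, d i.+1 y = x
    & forall i, (n < i)%N -> forall x : P i, x = 0].

Definition projective_resolution (n : nat) (M : lmodType A) : Prop :=
  exists (P : nat -> lmodType A) (d : forall i, {linear P i.+1 -> P i})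
         (eps : {linear P 0%N -> M}),
    (forall i, projective (P i)) /\ exact_resolution n d eps.

Definition graded_projective_resolution (n : nat) (M : gradedModule A) : Prop :=
  exists (P : nat -> gradedModule A) (d : forall i, {linear P i.+1 -> P i})
         (eps : {linear P 0%N -> M}),
    [/\ forall i, graded_projective (P i),
        forall i, graded_map (@mdeg _ _ _ (P i.+1)) (@mdeg _ _ _ (P i)) (d i),
        graded_map (@mdeg _ _ _ (P 0%N)) (@mdeg _ _ _ M) eps
      & @exact_resolution n (fun i => P i) M d eps].

(* Dimensions take values in the extended natural numbers, None being the
   infinite value. *)
Definition enat_least (p : nat -> Prop) : option nat :=
  if pselect (exists n, `[< p n >]) is left exp then Some (ex_minn exp) else None.

Definition enat_le (x : option nat) (n : nat) : bool :=
  if x is Some m then (m <= n)%N else false.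

Definition pdim (M : lmodType A) : option nat :=
  enat_least (fun n => projective_resolution n M).

Definition gr_pdim (M : gradedModule A) : option nat :=
  enat_least (fun n => graded_projective_resolution n M).

(* The supremum of gr_pdim M, as the least upper bound. *)
Definition gr_gldim : option nat :=
  enat_least (fun n => forall M : gradedModule A, enat_le (gr_pdim M) n).

End HomologicalDimensions.

(* iota identifies the graded A-module B with A^coH, with the grading induced
   by A and the action given by a . b = p_A (a b). *)
Definition is_coinvariants_module (G : zmodType) (k : fieldType)
    (chi : bicharacter G k) (H : colourHopfAlgebra chi)
    (A : comoduleColourAlgebra H) (theta : H -> A)
    (B : gradedModule A) (iota : {additive B -> A}) : Prop :=
  [/\ injective iota,
      forall x, coinvariant x <-> exists b, iota b = x,
      forall g b, mdeg g b <-> cdeg g (iota b)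
    & forall (a : A) b, iota (a *: b) = coinv_proj theta (a * iota b)].

(* Main.v *)
(* The map a |-> sum of theta(a_(-1)) (x) a_(0) makes A a colour-commutative Hopf
   algebra over B = A^coH with counit p_A, and B, being a graded division ring,
   has only projective graded modules. Accordingly, for graded A-modules X and M
   the space X (x)_k M carries the diagonal action
     a (x (x) m) = (|a_(0)| / |x|) theta(a_(-1)) x (x) a_(0) m.
   For X = H the outcome C(M) = H (x) M is projective, because B-linear lifts l
   on M extend by h (x) m |-> theta(h_1) l(theta(S(h_2)) m), and the counit of H
   gives a surjection C(M) -> M. Let Om M be its kernel. Coassociativity relates
   C(X) (x) M with C(X (x) M), so that (x) M preserves projective modules and the
   sequences 0 -> Om X -> C(X) -> X -> 0. As M is a retract of B (x) M, through
   b (x) m |-> b m, the n-th syzygy Om^n M is, up to projective modules, a retract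
   of (Om^n B) (x) M. If B has a projective resolution of length n over A, graded
   or not, then Om^n B is projective by Schanuel's argument, hence so is Om^n M,
   and every graded A-module M has a graded resolution of length n. *)
Require Import Defs.
From HB Require Import structures.
From mathcomp Require Import all_boot all_order all_algebra.
From mathcomp Require Import boolp.
From mathcomp Require classical_sets.

Set Implicit Arguments.
Unset Strict Implicit.
Unset Printing Implicit Defensive.

Local Open Scope ring_scope.

Import GRing.Theory.

Section LinearFunctions.
Variables (R : nzRingType) (U V W : lmodType R).

Definition mk_linear (f : U -> V) (lf : linear f) : {linear U -> V} :=
  HB.pack f (GRing.isLinear.Build _ _ _ _ _ lf).

Lemma fun_linD (f : U -> V) : linear f -> {morph f : x y / x + y}.
Proof. by move=> lf x y; have := lf 1 x y; rewrite !scale1r. Qed.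

Lemma fun_lin0 (f : U -> V) : linear f -> f 0 = 0.
Proof. by move=> lf; apply: (addIr (f 0)); rewrite -fun_linD // !add0r. Qed.

Lemma fun_linZ (f : U -> V) : linear f -> forall a, {morph f : x / a *: x}.
Proof. by move=> lf a x; have := lf a x 0; rewrite fun_lin0 // !addr0. Qed.

Lemma fun_linN (f : U -> V) : linear f -> {morph f : x / - x}.
Proof. by move=> lf x; rewrite -scaleN1r (fun_linZ lf) scaleN1r. Qed.

Lemma fun_linB (f : U -> V) : linear f -> {morph f : x y / x - y}.
Proof. by move=> lf x y; rewrite (fun_linD lf) (fun_linN lf). Qed.

Lemma fun_lin_sum (f : U -> V) : linear f ->
  forall (I : Type) (r : seq I) (P : pred I) F,
    f (\sum_(i <- r | P i) F i) = \sum_(i <- r | P i) f (F i).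
Proof. by move=> lf I r P F; apply: (big_morph f (fun_linD lf) (fun_lin0 lf)). Qed.

Lemma lin_id : linear (id : U -> U).
Proof. by []. Qed.

Lemma lin_comp (f : V -> W) (g : U -> V) :
  linear f -> linear g -> linear (fun x => f (g x)).
Proof. by move=> lf lg a x y; rewrite lg lf. Qed.

Lemma lin_sum (I : Type) (r : seq I) (F : I -> U -> V) :
  (forall i, linear (F i)) -> linear (fun x => \sum_(i <- r) F i x).
Proof.
move=> lF a x y; rewrite scaler_sumr -big_split; apply: eq_bigr => i _.
exact: lF.
Qed.

End LinearFunctions.

Lemma lin_scale (k : comNzRingType) (U V : lmodType k) (c : k) (f : U -> V) :
  linear f -> linear (fun x => c *: f x).
Proof. by move=> lf a x y; rewrite lf scalerDr !scalerA mulrC. Qed.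

(** * Homogeneous components *)

Section Components.
Variables (G V : zmodType) (D : G -> V -> Prop).

Definition is_decomp (s : seq G) (f : G -> V) (v : V) : Prop :=
  [/\ uniq s, forall g, D g (f g) & v = \sum_(g <- s) f g].

Definition decomp (v : V) : seq G * (G -> V) :=
  if pselect (exists sf : seq G * (G -> V), is_decomp sf.1 sf.2 v) is left e
  then projT1 (cid e) else ([::], fun=> 0).

Definition supp (v : V) : seq G := (decomp v).1.

Definition hcomp (g : G) (v : V) : V :=
  if g \in supp v then (decomp v).2 g else 0.

(* The additive map given by phi g on the elements of degree g. *)
Definition hext (W : zmodType) (phi : G -> V -> W) (v : V) : W :=
  \sum_(g <- supp v) phi g (hcomp g v).

Lemma big_if_mem (s u : seq G) (f : G -> V) : uniq s -> uniq u ->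
  {subset s <= u} ->
  \sum_(g <- u) (if g \in s then f g else 0) = \sum_(g <- s) f g.
Proof.
move=> us uu su; rewrite -big_mkcond -big_filter; apply: perm_big.
apply: uniq_perm => //; first exact: filter_uniq.
move=> g; rewrite mem_filter andb_idr //; exact: su.
Qed.

Hypothesis D_grading : is_grading D.

Lemma decompP v : is_decomp (decomp v).1 (decomp v).2 v.
Proof.
rewrite /decomp; case: pselect => [e|[]]; first by case: (cid e).
by have [_ _ /(_ v)[s [f fP]] _] := D_grading; exists (s, f).
Qed.

Lemma deg0 g : D g 0. Proof. by case: D_grading. Qed.

Lemma degB g v w : D g v -> D g w -> D g (v - w).
Proof. by case: D_grading => _ DB _ _; apply: DB. Qed.

Lemma degN g v : D g v -> D g (- v).
Proof. by move=> Dv; rewrite -sub0r; apply: degB => //; apply: deg0. Qed.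

Lemma degD g v w : D g v -> D g w -> D g (v + w).
Proof. by move=> Dv Dw; rewrite -[w]opprK; apply/degB/degN. Qed.

Lemma deg_sum g (I : eqType) (r : seq I) (P : pred I) (F : I -> V) :
  (forall i, i \in r -> P i -> D g (F i)) -> D g (\sum_(i <- r | P i) F i).
Proof.
move=> DF; rewrite big_seq_cond; elim/big_ind: _ => [|v w|i /andP[]].
- exact: deg0.
- exact: degD.
- exact: DF.
Qed.

Lemma hcompE s f v g : is_decomp s f v ->
  hcomp g v = if g \in s then f g else 0.
Proof.
case=> us Df vE; have [ut De vE'] := decompP v.
have [_ _ _ Dindep] := D_grading.
set e := (decomp v).2 in De vE' *; set t := (decomp v).1 in ut vE' *.
pose F g := (if g \in s then f g else 0) - (if g \in t then e g else 0).
pose u := undup (s ++ t).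
have su : {subset s <= u} by move=> x xs; rewrite mem_undup mem_cat xs.
have tu : {subset t <= u} by move=> x xs; rewrite mem_undup mem_cat xs orbT.
have D_F h : D h (F h) by apply: degB; case: ifP => _ //; apply: deg0.
have F0 : \sum_(h <- u) F h = 0.
  rewrite sumrB (big_if_mem _ us) ?undup_uniq // (big_if_mem _ ut) ?undup_uniq //.
  by rewrite -vE -vE' subrr.
have [gu|gu] := boolP (g \in u).
  have := Dindep u F (undup_uniq _) D_F F0 g gu.
  by move/eqP; rewrite subr_eq0 => /eqP ->.
rewrite /hcomp -[supp v]/t; case: ifP => [/tu|_]; first by rewrite (negPf gu).
by case: ifP => // /su; rewrite (negPf gu).
Qed.

Lemma hcomp_deg g v : D g (hcomp g v).
Proof.
by have [_ De _] := decompP v; rewrite /hcomp; case: ifP => // _; apply: deg0.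
Qed.

Lemma supp_uniq v : uniq (supp v). Proof. by case: (decompP v). Qed.

Lemma hcomp_out g v : g \notin supp v -> hcomp g v = 0.
Proof. by rewrite /hcomp => /negPf ->. Qed.

Lemma hcomp_sum_in s v : uniq s -> {subset supp v <= s} ->
  v = \sum_(g <- s) hcomp g v.
Proof.
move=> us sub; have [ut _ {1}->] := decompP v.
by rewrite -(big_if_mem _ ut us).
Qed.

Lemma hcomp_sum v : v = \sum_(g <- supp v) hcomp g v.
Proof. by apply: hcomp_sum_in => //; apply: supp_uniq. Qed.

Lemma hcompB g v w : hcomp g (v - w) = hcomp g v - hcomp g w.
Proof.
pose u := undup (supp v ++ supp w).
have uu : uniq u by apply: undup_uniq.
rewrite (@hcompE u (fun g => hcomp g v - hcomp g w)); last split=> //.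
- case: ifPn => //; rewrite mem_undup mem_cat negb_or => /andP[gv gw].
  by rewrite !hcomp_out // subrr.
- by move=> h; apply: degB; apply: hcomp_deg.
- rewrite sumrB -!hcomp_sum_in // => x; rewrite mem_undup mem_cat => ->//.
  by rewrite orbT.
Qed.

Lemma hcomp_id g v : D g v -> hcomp g v = v.
Proof.
move=> Dv; rewrite (@hcompE [:: g] (fun h => if h == g then v else 0)).
  by rewrite inE eqxx.
split=> // [h|]; last by rewrite big_seq1 eqxx.
by case: eqP => [->|_] //; apply: deg0.
Qed.

Lemma hcomp_neq g h v : D g v -> h != g -> hcomp h v = 0.
Proof.
move=> Dv hg; rewrite (@hcompE [:: g] (fun h => if h == g then v else 0)).
  by rewrite inE (negPf hg).
split=> // [h'|]; last by rewrite big_seq1 eqxx.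
by case: eqP => [->|_] //; apply: deg0.
Qed.

Lemma hcomp0 g : hcomp g 0 = 0.
Proof. by rewrite -[X in hcomp g X](subrr 0) hcompB subrr. Qed.

Lemma hcompD g v w : hcomp g (v + w) = hcomp g v + hcomp g w.
Proof.
by rewrite -[w in LHS]opprK hcompB -[- w]sub0r hcompB hcomp0 sub0r opprK.
Qed.

Lemma homog_ind (P : V -> Prop) :
  P 0 -> (forall v w, P v -> P w -> P (v + w)) ->
  (forall g v, D g v -> P v) -> forall v, P v.
Proof.
move=> P0 PD Ph v; rewrite (hcomp_sum v); elim/big_ind: _ => // g _.
exact/Ph/hcomp_deg.
Qed.

Section Extension.
Variables (W : zmodType) (phi : G -> V -> W).
Hypothesis phiD : forall g, {morph phi g : v w / v + w}.

Lemma phi0 g : phi g 0 = 0.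
Proof. by apply: (addIr (phi g 0)); rewrite -phiD !add0r. Qed.

Lemma hextE s v : uniq s -> {subset supp v <= s} ->
  hext phi v = \sum_(g <- s) phi g (hcomp g v).
Proof.
move=> us sub; rewrite /hext.
rewrite [RHS](bigID [in supp v] _ (fun g => phi g (hcomp g v))) /=.
rewrite [X in _ + X]big1 => [|g gv]; last by rewrite hcomp_out // phi0.
rewrite addr0 -[RHS]big_filter; apply: perm_big; apply: uniq_perm.
- exact: supp_uniq.
- exact: filter_uniq.
- by move=> g; rewrite mem_filter andb_idr //; apply: sub.
Qed.

Lemma hextD : {morph hext phi : v w / v + w}.
Proof.
move=> v w; pose u := undup (supp (v + w) ++ supp v ++ supp w).
have uu : uniq u by apply: undup_uniq.
rewrite !(@hextE u) // => [|g gs|g gs|g gs]; last 3 first.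
- by rewrite mem_undup !mem_cat gs ?orbT.
- by rewrite mem_undup !mem_cat gs ?orbT.
- by rewrite mem_undup !mem_cat gs ?orbT.
by rewrite -big_split; apply: eq_bigr => g _; rewrite hcompD phiD.
Qed.

Lemma hext_deg g v : D g v -> hext phi v = phi g v.
Proof.
move=> Dv; pose u := undup (g :: supp v).
have gu : g \in u by rewrite mem_undup inE eqxx.
rewrite (@hextE u) ?undup_uniq // => [|h hv]; last first.
  by rewrite mem_undup inE hv orbT.
rewrite (bigD1_seq g) ?undup_uniq //= hcomp_id // big1 ?addr0 // => h hg.
by rewrite (hcomp_neq Dv hg) phi0.
Qed.

End Extension.

End Components.

Section GradedSpaces.
Variables (G : zmodType) (k : fieldType) (V W : lmodType k) (D : G -> V -> Prop).
Hypothesis D_graded : is_graded_space D.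

Lemma hcompZ g a v : hcomp D g (a *: v) = a *: hcomp D g v.
Proof.
have [Dg DZ] := D_graded.
rewrite (@hcompE _ _ _ Dg (supp D v) (fun g => a *: hcomp D g v)).
  by case: ifPn => // gv; rewrite hcomp_out // scaler0.
split; [exact: supp_uniq | by move=> h; apply: DZ; apply: hcomp_deg |].
by rewrite -scaler_sumr -hcomp_sum.
Qed.

Lemma hcomp_lin g : linear (hcomp D g).
Proof. by have [Dg _] := D_graded; move=> a v w; rewrite hcompD // hcompZ. Qed.

Lemma hext_lin (phi : G -> V -> W) :
  (forall g, linear (phi g)) -> linear (hext D phi).
Proof.
have [Dg DZ] := D_graded; move=> lphi a v w.
have phiD g := fun_linD (lphi g).
rewrite (hextD Dg phiD); congr (_ + _).
elim/(homog_ind Dg): v => [|v v' IHv IHv'|g v Dv].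
- have h0 : hext D phi 0 = 0.
    by apply: (addIr (hext D phi 0)); rewrite -(hextD Dg phiD) !add0r.
  by rewrite scaler0 h0 scaler0.
- by rewrite scalerDr !(hextD Dg phiD) IHv IHv' scalerDr.
- by rewrite !(hext_deg Dg phiD (g := g)) ?(fun_linZ (lphi g)) //; apply: DZ.
Qed.

End GradedSpaces.

Lemma homog_lin_ext (G : zmodType) (k : fieldType) (V W : lmodType k)
    (D : G -> V -> Prop) (f h : V -> W) :
  is_grading D -> linear f -> linear h ->
  (forall g v, D g v -> f v = h v) -> f =1 h.
Proof.
move=> Dg lf lh fh; apply: (homog_ind Dg) => [|v w Hv Hw|//].
  by rewrite (fun_lin0 lf) (fun_lin0 lh).
by rewrite (fun_linD lf) (fun_linD lh) Hv Hw.
Qed.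

Lemma grading_of_projections (G V : zmodType) (D : G -> V -> Prop)
    (pr : G -> V -> V) :
  (forall g, D g 0) -> (forall g v w, D g v -> D g w -> D g (v - w)) ->
  (forall v, exists (s : seq G) (f : G -> V), is_decomp D s f v) ->
  (forall g, {morph pr g : v w / v + w}) ->
  (forall g v, D g v -> pr g v = v) ->
  (forall g h v, D h v -> h != g -> pr g v = 0) ->
  is_grading D.
Proof.
move=> D0 DB Dsum prD pr_id pr_neq; split=> // s f us Df f0 g gs.
have pr0 h : pr h 0 = 0 by apply: (addIr (pr h 0)); rewrite -prD !add0r.
have := congr1 (pr g) f0; rewrite (big_morph (pr g) (prD g) (pr0 g)) pr0.
rewrite (bigD1_seq g) //= pr_id // big1 ?addr0 // => h hg.
exact: pr_neq (Df h) hg.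
Qed.

(** * Tensor products *)

Section TensorLift.
Variables (k : fieldType) (M N P : lmodType k).

Definition is_bilinear (f : M -> N -> P) : Prop :=
  (forall n, linear (f^~ n)) /\ (forall m, linear (f m)).

Lemma tens_linl (n : N) : linear (fun m : M => tens m n).
Proof.
have tD (n' : N) (m m' : M) : tens (m + m') n' = tens m n' + tens m' n'.
  rewrite /tens -[RHS]/(tens_add _ _) tens_pi_add.
  by apply: (tens_piP _ _).1; apply: TensAddl.
move=> a m m'; rewrite tD; congr (_ + _).
rewrite -[RHS]/(tens_scale a _) /tens tens_pi_scale //.
Qed.

Lemma tens_linr (m : M) : linear (fun n : N => tens m n).
Proof.
have tD (n n' : N) : tens m (n + n') = tens m n + tens m n'.
  rewrite /tens -[RHS]/(tens_add _ _) tens_pi_add.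
  by apply: (tens_piP _ _).1; apply: TensAddr.
move=> a n n'; rewrite tD; congr (_ + _).
rewrite -[RHS]/(tens_scale a _) /tens tens_pi_scale.
by apply: (tens_piP _ _).1; apply: TensSym; apply: TensScale.
Qed.

Lemma tens_ind (Q : tensor M N -> Prop) :
  Q 0 -> (forall x y, Q x -> Q y -> Q (x + y)) ->
  (forall m n, Q (tens m n)) -> forall x, Q x.
Proof.
move=> Q0 QD Qt; elim/tensW=> s; rewrite tens_pi_sum.
by elim/big_ind: _ => // -[m n] _.
Qed.

Lemma tens_lin_ext (f h : tensor M N -> P) : linear f -> linear h ->
  (forall m n, f (tens m n) = h (tens m n)) -> f =1 h.
Proof.
move=> lf lh fh; apply: tens_ind => [|x y Hx Hy|//].
  by rewrite (fun_lin0 lf) (fun_lin0 lh).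
by rewrite (fun_linD lf) (fun_linD lh) Hx Hy.
Qed.

Variable f : M -> N -> P.
Hypothesis f_bil : is_bilinear f.

Lemma lift_tens m n : tens_lift f (tens m n) = f m n.
Proof. by case: f_bil => fl fr; apply: tens_liftE. Qed.

Lemma lift_lin : linear (tens_lift f).
Proof. by case: f_bil => fl fr; apply: tens_lift_linear. Qed.

Lemma lift_sum (I : Type) (s : seq I) (a : I -> M) (b : I -> N) :
  tens_lift f (\sum_(i <- s) tens (a i) (b i)) = \sum_(i <- s) f (a i) (b i).
Proof.
by rewrite (fun_lin_sum lift_lin); apply: eq_bigr => i _; apply: lift_tens.
Qed.

End TensorLift.

Lemma tens_bilinear (k : fieldType) (M N : lmodType k) :
  is_bilinear (@tens k M N).
Proof. by split; [apply: tens_linl | apply: tens_linr]. Qed.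

Lemma bilinear_comp (k : fieldType) (M N P M' N' P' : lmodType k)
    (f : M -> N -> P) (u : M' -> M) (v : N' -> N) (w : P -> P') :
  is_bilinear f -> linear u -> linear v -> linear w ->
  is_bilinear (fun m n => w (f (u m) (v n))).
Proof.
case=> fl fr lu lv lw; split=> [n|m] a x y; rewrite /= ?lu ?lv.
  by rewrite (fl (v n)) lw.
by rewrite (fr (u m)) lw.
Qed.

Lemma tens_lift_id (k : fieldType) (M N : lmodType k) (z : tensor M N) :
  z = tens_lift (@tens k M N) z.
Proof.
apply: (@tens_lin_ext _ _ _ _ id) => // [|m n].
  exact/lift_lin/tens_bilinear.
by rewrite lift_tens //; apply: tens_bilinear.
Qed.

(* As tens_lift f z is a sum over the terms of an expression of z, it serves as
   the Sweedler sum of f(z_1, z_2), and additive maps commute with it even when f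
   is not bilinear. *)
Section LiftOperations.
Variables (k : fieldType) (M N P Q : lmodType k).
Implicit Types f h : M -> N -> P.

Lemma eq_lift f h z : (forall m n, f m n = h m n) ->
  tens_lift f z = tens_lift h z.
Proof. by move=> fh; apply: eq_bigr => p _; apply: fh. Qed.

Lemma lift_comp f (u : P -> Q) z : linear u ->
  u (tens_lift f z) = tens_lift (fun m n => u (f m n)) z.
Proof. by move=> lu; apply: fun_lin_sum. Qed.

Lemma lift_param (U : lmodType k) (F : U -> M -> N -> P) z :
  (forall m n, linear (fun u => F u m n)) ->
  linear (fun u => tens_lift (F u) z).
Proof. by move=> lF; apply: lin_sum => p; apply: lF. Qed.

End LiftOperations.

Section TensorGrading.
Variables (G : zmodType) (k : fieldType) (M N : lmodType k).
Variables (DM : G -> M -> Prop) (DN : G -> N -> Prop).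
Hypotheses (DM_graded : is_graded_space DM) (DN_graded : is_graded_space DN).
Local Notation DT := (tens_deg DM DN).

Lemma tens_deg_tens g h m n : DM g m -> DN h n -> DT (g + h) (tens m n).
Proof.
move=> Dm Dn; exists [:: ((g, h), (m, n))]; last first.
  by move=> p; rewrite inE => /eqP ->.
by split=> [p|]; rewrite ?big_seq1 // inE => /eqP ->.
Qed.

Lemma tens_deg0 g : DT g 0.
Proof. by exists [::] => //; split=> //; rewrite big_nil. Qed.

Lemma tens_degD g x y : DT g x -> DT g y -> DT g (x + y).
Proof.
move=> [s [sP ->] sg] [t [tP ->] tg]; exists (s ++ t).
  by split=> [p|]; rewrite ?big_cat // mem_cat => /orP[/sP|/tP].
by move=> p; rewrite mem_cat => /orP[/sg|/tg].
Qed.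

Lemma tens_deg_ind g (Q : tensor M N -> Prop) :
  Q 0 -> (forall x y, Q x -> Q y -> Q (x + y)) ->
  (forall h h' m n, DM h m -> DN h' n -> h + h' = g -> Q (tens m n)) ->
  forall x, DT g x -> Q x.
Proof.
move=> Q0 QD Qt x [s [sP ->] sg]; rewrite big_seq.
elim/big_ind: _ => // -[[h h'] [m n]] ps.
by have [] := sP _ ps; move: (sg _ ps) => /= hg Dm Dn; apply: Qt Dm Dn hg.
Qed.

Lemma tens_degZ g a x : DT g x -> DT g (a *: x).
Proof.
elim/tens_deg_ind: x / => [|x y|h h' m n Dm Dn <-].
- by rewrite scaler0; apply: tens_deg0.
- by rewrite scalerDr; apply: tens_degD.
- rewrite -(fun_linZ (tens_linl n)); apply: tens_deg_tens => //.
  by case: DM_graded => _; apply.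
Qed.

(* The component of degree g collects the tensors of degrees h and g - h. *)
Definition tens_hcomp (g : G) : tensor M N -> tensor M N :=
  tens_lift (fun m n => hext DM (fun h m' => tens m' (hcomp DN (g - h) n)) m).

Lemma tens_hcomp_bil g :
  is_bilinear (fun m n => hext DM (fun h m' => tens m' (hcomp DN (g - h) n)) m).
Proof.
split=> [n|m]; first by apply: hext_lin => // h; apply: tens_linl.
apply: lin_sum => h; apply: (lin_comp (tens_linr _)); exact: hcomp_lin.
Qed.

Lemma tens_hcompE g h h' m n : DM h m -> DN h' n ->
  tens_hcomp g (tens m n) = if h + h' == g then tens m n else 0.
Proof.
case: DM_graded DN_graded => [DMg _] [DNg _] Dm Dn.
rewrite /tens_hcomp lift_tens; last exact: tens_hcomp_bil.
rewrite (hext_deg DMg _ Dm) => [|h1]; last exact: fun_linD (tens_linl _).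
case: eqP => [<-|neq]; first by rewrite [h + h']addrC addrK (hcomp_id DNg Dn).
rewrite (hcomp_neq DNg Dn) ?(fun_lin0 (tens_linr m)) //.
by apply/eqP => E; apply: neq; rewrite -E addrC subrK.
Qed.

Lemma tens_hcomp_lin g : linear (tens_hcomp g).
Proof. exact/lift_lin/tens_hcomp_bil. Qed.

Lemma tens_graded : is_graded_space DT.
Proof.
case: (DM_graded) (DN_graded) => [DMg _] [DNg _].
split; last exact: tens_degZ.
apply: (grading_of_projections (pr := tens_hcomp)).
- exact: tens_deg0.
- move=> g x y Dx Dy; apply: tens_degD => //.
  by rewrite -scaleN1r; apply: tens_degZ.
- move=> x; have [s [sP ->]] := homogeneous_sum_exists x DMg DNg.
  pose d (p : (G * G) * (M * N)) := p.1.1 + p.1.2.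
  exists (undup [seq d p | p <- s]).
  exists (fun g => \sum_(p <- s | d p == g) tens p.2.1 p.2.2).
  split; first exact: undup_uniq.
    move=> g; rewrite big_seq_cond; elim/big_ind: _ => [|x' y'|p].
    + exact: tens_deg0.
    + exact: tens_degD.
    + case/andP=> /sP[Dm Dn] /eqP <-; exact: tens_deg_tens.
  rewrite (exchange_big_dep xpredT) //= big_seq [RHS]big_seq.
  apply: eq_bigr => p ps; rewrite -big_filter.
  rewrite (_ : [seq _ <- _ | _] = [:: d p]) ?big_seq1 //.
  rewrite -(filter_pred1_uniq (undup_uniq [seq d p | p <- s])) ?mem_undup ?map_f //.
  by apply: eq_filter => g /=; rewrite eq_sym.
- by move=> g; apply/fun_linD/tens_hcomp_lin.
- move=> g x; elim/tens_deg_ind: x / => [|x y Hx Hy|h h' m n Dm Dn E].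
  + exact: fun_lin0 (tens_hcomp_lin g).
  + by rewrite (fun_linD (tens_hcomp_lin g)) Hx Hy.
  + by rewrite (tens_hcompE _ Dm Dn) E eqxx.
- move=> g h x Dx hg; elim/tens_deg_ind: x / Dx => [|x y Hx Hy|h1 h' m n Dm Dn E].
  + exact: fun_lin0 (tens_hcomp_lin g).
  + by rewrite (fun_linD (tens_hcomp_lin g)) Hx Hy addr0.
  + by rewrite (tens_hcompE _ Dm Dn) E (negPf hg).
Qed.

Lemma tens_homog_lin_ext (P : lmodType k) (f h : tensor M N -> P) :
  linear f -> linear h ->
  (forall g g' m n, DM g m -> DN g' n -> f (tens m n) = h (tens m n)) ->
  f =1 h.
Proof.
case: (DM_graded) (DN_graded) => [DMg _] [DNg _] lf lh fh.
apply: tens_lin_ext => // m n.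
apply: (homog_lin_ext DMg (lin_comp lf (tens_linl n)) (lin_comp lh (tens_linl n))).
move=> g {}m Dm.
apply: (homog_lin_ext DNg (lin_comp lf (tens_linr m)) (lin_comp lh (tens_linr m))).
by move=> g' {}n Dn; apply: fh Dm Dn.
Qed.

End TensorGrading.

Section TensorAssociativity.
Variables (k : fieldType) (L M N P : lmodType k).

Definition is_trilinear (F : L -> M -> N -> P) : Prop :=
  [/\ forall m n, linear (fun l => F l m n),
      forall l n, linear (fun m => F l m n) & forall l m, linear (F l m)].

Variable F : L -> M -> N -> P.
Hypothesis F_tri : is_trilinear F.

Definition tens_lift3 (z : tensor L (tensor M N)) : P :=
  tens_lift (fun l y => tens_lift (F l) y) z.

Lemma tens_lift3_bil : is_bilinear (fun l y => tens_lift (F l) y).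
Proof.
have [Fl Fm Fn] := F_tri; split=> [y|l].
  by apply: (lift_param (F := F)) => m n; apply: Fl.
by apply: lift_lin; split=> [n|m]; [apply: Fm | apply: Fn].
Qed.

Lemma tens_lift3E l m n : tens_lift3 (tens l (tens m n)) = F l m n.
Proof.
have [Fl Fm Fn] := F_tri; rewrite /tens_lift3 lift_tens; last exact: tens_lift3_bil.
by rewrite lift_tens.
Qed.

Lemma tens_lift3_lin : linear tens_lift3.
Proof. exact/lift_lin/tens_lift3_bil. Qed.

Lemma tens_assoc_bil :
  is_bilinear (fun (x : tensor L M) (n : N) =>
    tens_lift (fun l m => tens l (tens m n)) x).
Proof.
have bil n : is_bilinear (fun (l : L) (m : M) => tens l (tens m n)).
  split=> [m|l]; first exact: tens_linl.
  exact: (lin_comp (tens_linr l) (tens_linl n)).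
split=> [n|x]; first exact/lift_lin/bil.
apply: lift_param => l m; exact: (lin_comp (tens_linr l) (tens_linr m)).
Qed.

Lemma tens_assocE (l : L) (m : M) (n : N) :
  tens_assoc (tens (tens l m) n) = tens l (tens m n).
Proof.
rewrite /tens_assoc lift_tens; last exact: tens_assoc_bil.
rewrite lift_tens //; split=> [m'|l']; first exact: tens_linl.
exact: (lin_comp (tens_linr l') (tens_linl n)).
Qed.

Lemma tens_assoc_lin : linear (@tens_assoc k L M N).
Proof. exact/lift_lin/tens_assoc_bil. Qed.

Lemma lift3_assoc (z : tensor (tensor L M) N) :
  tens_lift3 (tens_assoc z) =
  tens_lift (fun x n => tens_lift (fun l m => F l m n) x) z.
Proof.
have [Fl Fm Fn] := F_tri.
have bil n : is_bilinear (fun l m => F l m n).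
  by split=> [m|l]; [apply: Fl|apply: Fm].
have bil2 : is_bilinear (fun x n => tens_lift (fun l m => F l m n) x).
  split=> [n|x]; first exact/lift_lin/bil.
  by apply: lift_param => l m; apply: Fn.
apply: (tens_lin_ext (lin_comp tens_lift3_lin tens_assoc_lin) (lift_lin bil2)).
move=> x n; rewrite lift_tens //.
apply: (tens_lin_ext (f := fun x => tens_lift3 (tens_assoc (tens x n))))
  => [||l m] /=.
- apply: (lin_comp tens_lift3_lin); apply: (lin_comp tens_assoc_lin).
  exact: tens_linl.
- exact: lift_lin.
- by rewrite tens_assocE tens_lift3E lift_tens.
Qed.

End TensorAssociativity.

Section TensorMap.
Variables (k : fieldType) (M N M' N' P : lmodType k).

Lemma tens_map_bil (u : M -> M') (v : N -> N') : linear u -> linear v ->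
  is_bilinear (fun m n => tens (u m) (v n)).
Proof.
by move=> lu lv; apply: (bilinear_comp (w := id) (tens_bilinear _ _)).
Qed.

Lemma tens_mapE (u : M -> M') (v : N -> N') m n : linear u -> linear v ->
  tens_map u v (tens m n) = tens (u m) (v n).
Proof. by move=> lu lv; rewrite /tens_map lift_tens //; apply: tens_map_bil. Qed.

Lemma tens_map_lin (u : M -> M') (v : N -> N') : linear u -> linear v ->
  linear (tens_map u v).
Proof. by move=> lu lv; apply: lift_lin; apply: tens_map_bil. Qed.

Lemma lift_map (f : M' -> N' -> P) (u : M -> M') (v : N -> N') z :
  is_bilinear f -> linear u -> linear v ->
  tens_lift f (tens_map u v z) = tens_lift (fun m n => f (u m) (v n)) z.
Proof.
move=> bf lu lv; rewrite /tens_map (lift_comp _ _ (lift_lin bf)).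
by apply: eq_lift => m n; rewrite lift_tens.
Qed.

End TensorMap.

Lemma mul_bilinear (k : fieldType) (R : algType k) : is_bilinear (@GRing.mul R).
Proof.
split=> [y|x] a u v /=; first by rewrite mulrDl scalerAl.
by rewrite mulrDr scalerAr.
Qed.

(** * Graded modules and the diagonal action *)

Record gmodule (G : zmodType) (k : fieldType) (R : colourAlgebra G k) :=
  GModule {
  gcar :> lmodType k;
  gdeg : G -> gcar -> Prop;
  gdegP : is_graded_space gdeg;
  gact : R -> gcar -> gcar;
  gact_bil : is_bilinear gact;
  gactA : forall a b m, gact (a * b) m = gact a (gact b m);
  gact1 : forall m, gact 1 m = m;
  gact_deg : forall g g' a m, cdeg g a -> gdeg g' m -> gdeg (g + g') (gact a m)
}.

Definition regular_gmodule (G : zmodType) (k : fieldType)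
    (R : colourAlgebra G k) : gmodule R :=
  @GModule G k R R (@cdeg _ _ R) (cdeg_graded R) *%R (mul_bilinear R)
    (fun a b m => esym (mulrA a b m)) (@mul1r R) (@cdegM _ _ R).

Lemma restrict_gmodule_bil (G : zmodType) (k : fieldType)
    (R S : colourAlgebra G k) (f : {lrmorphism R -> S}) (M : gmodule S) :
  is_bilinear (fun (a : R) (m : M) => gact (f a) m).
Proof.
have [gl gr] := gact_bil M; split=> [m|a]; last exact: gr.
apply: (lin_comp (gl m)); exact: linearP.
Qed.

Definition restrict_gmodule (G : zmodType) (k : fieldType)
    (R S : colourAlgebra G k) (f : {lrmorphism R -> S})
    (f_graded : graded_map (@cdeg _ _ R) (@cdeg _ _ S) f)
    (M : gmodule S) : gmodule R.
Proof.
apply: (@GModule G k R M (@gdeg _ _ _ M) (gdegP M)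
  (fun a m => gact (f a) m) (restrict_gmodule_bil f M)).
- by move=> a b m; rewrite rmorphM gactA.
- by move=> m; rewrite rmorph1 gact1.
- by move=> g g' a m Da Dm; apply: gact_deg => //; apply: f_graded.
Defined.

Lemma bich0r (G : zmodType) (k : fieldType) (chi : bicharacter G k) g : chi g 0 = 1.
Proof.
have := bichDr chi g 0 0; rewrite addr0 => /eqP.
by rewrite -{1}[chi g 0]mulr1 (inj_eq (mulfI (bich_neq0 chi _ _))) => /eqP.
Qed.

Lemma bich0l (G : zmodType) (k : fieldType) (chi : bicharacter G k) g : chi 0 g = 1.
Proof.
have := bichDl chi 0 0 g; rewrite addr0 => /eqP.
by rewrite -{1}[chi 0 g]mulr1 (inj_eq (mulfI (bich_neq0 chi _ _))) => /eqP.
Qed.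

Section DiagonalAction.
Variables (G : zmodType) (k : fieldType) (chi : bicharacter G k).
Variables (H : colourHopfAlgebra chi) (A : comoduleColourAlgebra H).
Variables (P : gmodule H) (M : gmodule A).
Local Notation T := (tensor P M).
Local Notation DT := (tens_deg (@gdeg _ _ _ P) (@gdeg _ _ _ M)).

Definition twist (g : G) : P -> P :=
  hext (@gdeg _ _ _ P) (fun g' p => chi g g' *: p).

Lemma twist_lin g : linear (twist g).
Proof. by apply: (hext_lin (gdegP P)) => g'; apply: lin_scale => a u v. Qed.

Lemma twist_deg g g' p : gdeg g' p -> twist g p = chi g g' *: p.
Proof.
move=> Dp; rewrite /twist (hext_deg (gdegP P).1 _ Dp) // => h.
exact: scalerDr.
Qed.

Definition pair_act_tens (h : H) (a : A) (p : P) (m : M) : T :=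
  hext (@cdeg _ _ A)
    (fun g a' => tens (gact h (twist g p)) (gact a' m)) a.

Lemma pair_act_tens_linh a p m : linear (fun h => pair_act_tens h a p m).
Proof.
apply: lin_sum => g; apply: (lin_comp (tens_linl _)).
by case: (gact_bil P) => + _; apply.
Qed.

Lemma pair_act_tens_lina h p m : linear (fun a => pair_act_tens h a p m).
Proof.
apply: (hext_lin (cdeg_graded A)) => g; apply: (lin_comp (tens_linr _)).
by case: (gact_bil M) => + _; apply.
Qed.

Lemma pair_act_tens_bil h a : is_bilinear (pair_act_tens h a).
Proof.
split=> [m|p]; apply: lin_sum => g.
  apply: (lin_comp (tens_linl _)); apply: (lin_comp _ (@twist_lin g)).
  by case: (gact_bil P).
by apply: (lin_comp (tens_linr _)); case: (gact_bil M).
Qed.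

(* The action of h (x) a on P (x) M, with the sign (|a| / |p|). *)
Definition pair_act (h : H) (a : A) : T -> T :=
  tens_lift (pair_act_tens h a).

Lemma pair_act_lin h a : linear (pair_act h a).
Proof. exact/lift_lin/pair_act_tens_bil. Qed.

Lemma pair_act_bil x : is_bilinear (fun h a => pair_act h a x).
Proof.
split=> [a|h]; apply: lift_param => p m.
  exact: pair_act_tens_linh.
exact: pair_act_tens_lina.
Qed.

Lemma pair_actE h a p m g g' : cdeg g a -> gdeg g' p ->
  pair_act h a (tens p m) = chi g g' *: tens (gact h p) (gact a m).
Proof.
move=> Da Dp; rewrite /pair_act lift_tens; last exact: pair_act_tens_bil.
rewrite /pair_act_tens (hext_deg (cdeg_graded A).1 _ Da) => [|h'].
  rewrite (twist_deg _ Dp) (fun_linZ ((gact_bil P).2 h)).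
  by rewrite (fun_linZ (tens_linl _)).
apply: fun_linD; apply: (lin_comp (tens_linr _)).
by case: (gact_bil M) => + _; apply.
Qed.

Lemma pair_act_mul h a h' a' g g' x : cdeg g a -> cdeg g' h' ->
  pair_act h a (pair_act h' a' x) =
  chi g g' *: pair_act (h * h') (a * a') x.
Proof.
move=> Da Dh.
have l2 : linear (fun b => chi g g' *: pair_act (h * h') (a * b) x).
  apply: lin_scale; apply: (lin_comp ((pair_act_bil _).2 _)).
  exact: (mul_bilinear A).2.
apply: (homog_lin_ext (cdeg_graded A).1 (lin_comp (pair_act_lin h a)
  ((pair_act_bil x).2 h')) l2) => d {l2}a' Da' /=.
apply: (tens_homog_lin_ext (gdegP P) (gdegP M) (lin_comp (pair_act_lin h a)
  (pair_act_lin h' a')) (lin_scale _ (pair_act_lin _ _))).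
move=> e e' p m Dp _ /=.
rewrite (pair_actE _ _ Da' Dp) (fun_linZ (pair_act_lin h a)).
rewrite (pair_actE _ _ Da (gact_deg Dh Dp)) (pair_actE _ _ (cdegM Da Da') Dp).
rewrite !scalerA -!gactA; congr (_ *: _).
by rewrite bichDr bichDl mulrC mulrA.
Qed.

Lemma pair_act_deg g g' h a x d :
  cdeg g h -> cdeg g' a -> DT d x -> DT (g + g' + d) (pair_act h a x).
Proof.
move=> Dh Da; elim/tens_deg_ind: x / => [|x y Hx Hy|e e' p m Dp Dm <-].
- by rewrite (fun_lin0 (pair_act_lin h a)); apply: tens_deg0.
- by rewrite (fun_linD (pair_act_lin h a)); apply: tens_degD.
- rewrite (pair_actE _ _ Da Dp) addrACA; apply: tens_degZ; first exact: gdegP.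
  by apply: tens_deg_tens; apply: gact_deg.
Qed.

Definition diag_act (a : A) (x : T) : T :=
  tens_lift (fun h a' => pair_act h a' x) (coact A a).

Lemma diag_act_bil : is_bilinear diag_act.
Proof.
split=> [x|a].
  apply: (lin_comp (lift_lin (pair_act_bil x))); exact: linearP.
by apply: lift_param => h a'; apply: pair_act_lin.
Qed.

Lemma diag_act_sum a x (I : Type) (s : seq I) (h : I -> H) (b : I -> A) :
  coact A a = \sum_(i <- s) tens (h i) (b i) ->
  diag_act a x = \sum_(i <- s) pair_act (h i) (b i) x.
Proof. by rewrite /diag_act => ->; rewrite (lift_sum (pair_act_bil x)). Qed.

Lemma coact_homogeneous (a : A) : exists s,
  homogeneous_sum (@cdeg _ _ H) (@cdeg _ _ A) s (coact A a).
Proof.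
apply: homogeneous_sum_exists; exact: (cdeg_graded _).1.
Qed.

Lemma diag_actA a b x : diag_act (a * b) x = diag_act a (diag_act b x).
Proof.
have [s [sP sE]] := coact_homogeneous a; have [t [tP tE]] := coact_homogeneous b.
have := coactM (conj sP sE) (conj tP tE).
rewrite (diag_act_sum _ sE) /diag_act => ->.
rewrite (fun_lin_sum (lift_lin (pair_act_bil x))) big_seq [RHS]big_seq.
apply: eq_bigr => p ps; have [_ Da] := sP p ps.
rewrite -/(diag_act b x) (diag_act_sum _ tE).
rewrite (fun_lin_sum (lift_lin (pair_act_bil x))).
rewrite (fun_lin_sum (pair_act_lin _ _)) big_seq [RHS]big_seq.
apply: eq_bigr => q qt; have [Dh _] := tP q qt.
rewrite (pair_act_mul _ _ _ Da Dh) (fun_linZ (lift_lin (pair_act_bil x))).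
by rewrite lift_tens //; apply: pair_act_bil.
Qed.

Lemma diag_act1 x : diag_act 1 x = x.
Proof.
rewrite /diag_act coact1 lift_tens; last exact: pair_act_bil.
apply: (tens_homog_lin_ext (gdegP P) (gdegP M) (h := id)) => //.
  exact: pair_act_lin.
move=> g g' p m Dp Dm.
by rewrite (pair_actE _ _ (cdeg1 A) Dp) bich0l scale1r !gact1.
Qed.

Lemma diag_act_deg g g' a x : cdeg g a -> DT g' x -> DT (g + g') (diag_act a x).
Proof.
move=> Da Dx; have [_ coactD _ _] := coactP A.
have [s [sP sE] sg] := coactD g a Da.
rewrite (diag_act_sum _ sE) big_seq; elim/big_ind: _ => [|y z|p ps].
- exact: tens_deg0.
- exact: tens_degD.
- by rewrite -(sg p ps); have [Dh Da'] := sP p ps; apply: pair_act_deg.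
Qed.

Definition diag_gmodule : gmodule A :=
  GModule (tens_graded (gdegP P) (gdegP M)) diag_act_bil diag_actA diag_act1
    diag_act_deg.

End DiagonalAction.

Section Kernel.
Variables (R : nzRingType) (U V : lmodType R) (f : {linear U -> V}).

Definition ker_pred : pred U := fun u => f u == 0.

Lemma ker_closed : GRing.submod_closed ker_pred.
Proof.
split; first by rewrite unfold_in /ker_pred linear0.
move=> a u v; rewrite !unfold_in /ker_pred linearP => /eqP -> /eqP ->.
by rewrite scaler0 addr0.
Qed.

HB.instance Definition _ :=
  GRing.isSubmodClosed.Build R U ker_pred ker_closed.

Record kernel := Kernel { kval :> U; kvalP : kval \in ker_pred }.

HB.instance Definition _ := [isSub for kval].
HB.instance Definition _ := [Choice of kernel by <:].
HB.instance Definition _ := [SubChoice_isSubLmodule of kernel by <:].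

Definition to_kernel (u : U) (fu : f u = 0) : kernel :=
  @Kernel u (introT eqP fu).

Lemma kernelE (x : kernel) : f (kval x) = 0.
Proof. by apply/eqP; apply: (kvalP x). Qed.

Lemma kval_inj : injective kval.
Proof. exact: val_inj. Qed.

Lemma kval_lin : linear kval.
Proof. by move=> a x y; rewrite -[kval]/(val : kernel -> U) linearP. Qed.

End Kernel.

(** * The projection onto the coinvariants *)

Section CoproductIdentities.
Variables (G : zmodType) (k : fieldType) (chi : bicharacter G k).
Variables (H : colourHopfAlgebra chi) (A : comoduleColourAlgebra H).
Variables (W : lmodType k).

Lemma lift3_coassoc (M : lmodType k) (d : {linear M -> tensor H M})
    (F : H -> H -> M -> W) m : is_trilinear F ->
  tens_assoc (tens_map (comult H) id (d m)) = tens_map id d (d m) ->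
  tens_lift (fun h m' => tens_lift (fun h1 h2 => F h1 h2 m') (comult H h)) (d m)
  = tens_lift (fun h m' => tens_lift (F h) (d m')) (d m).
Proof.
move=> Ftri /(congr1 (tens_lift3 F)); rewrite (lift3_assoc Ftri).
have [Fl Fm Fn] := Ftri.
have lD : linear (comult H) := @linearP _ _ _ _ _.
have ld : linear d := @linearP _ _ _ _ _.
have lid (V : lmodType k) : linear (id : V -> V) by [].
rewrite lift_map //; last first.
  split=> [n|x]; last by apply: lift_param => l m'; apply: Fn.
  by apply: lift_lin; split=> [m'|l]; [apply: Fl|apply: Fm].
by move=> ->; rewrite /tens_lift3 lift_map //; apply: tens_lift3_bil.
Qed.

Lemma coact_coassoc (F : H -> H -> A -> W) a : is_trilinear F ->
  tens_lift (fun h a' => tens_lift (fun h1 h2 => F h1 h2 a') (comult H h))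
    (coact A a) =
  tens_lift (fun h a' => tens_lift (F h) (coact A a')) (coact A a).
Proof. by move=> ?; apply: lift3_coassoc => //; case: (coactP A). Qed.

Lemma comult_coassoc (F : H -> H -> H -> W) h : is_trilinear F ->
  tens_lift (fun h1 h2 => tens_lift (fun h1' h1'' => F h1' h1'' h2)
    (comult H h1)) (comult H h) =
  tens_lift (fun h1 h2 => tens_lift (F h1) (comult H h2)) (comult H h).
Proof. by move=> ?; apply: lift3_coassoc => //; apply: comultA. Qed.

(* The counit with values in k rather than in k^o, so that its values scale the
   elements of a k-module. *)
Definition hcounit (h : H) : k := counit H h.

Lemma coact_counit (X : A -> W) a : linear X ->
  tens_lift (fun h a' => hcounit h *: X a') (coact A a) = X a.
Proof.
move=> lX; have [_ _ _ /(_ a)] := coactP A => aE.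
have {}aE : tens_lift (fun h (a' : A) => hcounit h *: a') (coact A a) = a := aE.
rewrite -[in RHS]aE (lift_comp _ _ lX); apply: eq_lift => h a'.
by rewrite (fun_linZ lX).
Qed.

Lemma hcounit_scale_lin (w : W) : linear (fun h => hcounit h *: w).
Proof.
move=> c x y; rewrite /hcounit linearP scalerDl; congr (_ + _).
exact: esym (scalerA _ _ _).
Qed.

Lemma hcounitM h h' : hcounit (h * h') = hcounit h * hcounit h'.
Proof. exact: counitM. Qed.

Lemma hcounit_deg g (h : H) : cdeg g h -> g != 0 -> hcounit h = 0.
Proof. by move=> Dh; apply: (counit_graded Dh). Qed.

End CoproductIdentities.

Section Coinvariants.
Variables (G : zmodType) (k : fieldType) (chi : bicharacter G k).
Variables (H : colourHopfAlgebra chi) (A : comoduleColourAlgebra H).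
Variable theta : {lrmorphism H -> A}.
Hypothesis theta_colinear : colinear_from_hopf theta.
Local Notation S := (antipode H).
Local Notation RH := (regular_gmodule H).
Local Notation RA := (regular_gmodule A).
Local Notation p := (coinv_proj theta).

Lemma theta_lin : linear theta. Proof. exact: linearP. Qed.
Lemma antipode_lin : linear S. Proof. exact: linearP. Qed.
Lemma coact_lin : linear (coact A). Proof. exact: linearP. Qed.

Lemma lift_coact_theta (W : lmodType k) (F : H -> A -> W) h : is_bilinear F ->
  tens_lift F (coact A (theta h)) =
  tens_lift (fun h1 h2 => F h1 (theta h2)) (comult H h).
Proof.
by move=> bF; rewrite theta_colinear lift_map //; apply: theta_lin.
Qed.

Lemma coinv_proj_bil :
  is_bilinear (fun (h : H) (a : A) => theta (S h) * a).
Proof.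
apply: (bilinear_comp (mul_bilinear A) (u := fun h => theta (S h)) (v := id)
  (w := id)) => //.
exact: (lin_comp theta_lin antipode_lin).
Qed.

Lemma coinv_proj_lin : linear p.
Proof. exact: (lin_comp (lift_lin coinv_proj_bil) coact_lin). Qed.

Lemma theta_antipoder h :
  tens_lift (fun h1 h2 => theta h1 * theta (S h2)) (comult H h) =
  (hcounit h)%:A.
Proof.
rewrite -(eq_lift (f := fun h1 h2 => theta (h1 * S h2))) => [|*]; last first.
  by rewrite rmorphM.
rewrite -(lift_comp (fun h1 h2 : H => h1 * S h2) _ theta_lin) antipoder.
by rewrite linearZ /= rmorph1.
Qed.

Lemma theta_antipodel h :
  tens_lift (fun h1 h2 => theta (S h1) * theta h2) (comult H h) =
  (hcounit h)%:A.
Proof.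
rewrite -(eq_lift (f := fun h1 h2 => theta (S h1 * h2))) => [|*]; last first.
  by rewrite rmorphM.
rewrite -(lift_comp (fun h1 h2 : H => S h1 * h2) _ theta_lin) antipodel.
by rewrite linearZ /= rmorph1.
Qed.

Section UnitTensor.
Variable N : gmodule A.

Lemma pair_act_unit h (a : A) (n : N) :
  pair_act h a (tens (1 : RH) n) = tens (h : RH) (gact a n).
Proof.
have [Nl _] := gact_bil N.
apply: (homog_lin_ext (cdeg_graded A).1 ((pair_act_bil (tens (1 : RH) n)).2 h)
  (lin_comp (tens_linr (h : RH)) (Nl n))) => g {}a Da /=.
rewrite (@pair_actE _ _ _ _ _ RH N h a 1 n g 0 Da (cdeg1 H)).
by rewrite bich0r scale1r /= mulr1.
Qed.

Lemma diag_act_unit (a : A) (n : N) :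
  diag_act a (tens (1 : RH) n) =
  tens_lift (fun h a' => tens (h : RH) (gact a' n)) (coact A a).
Proof. by apply: eq_lift => h a'; apply: pair_act_unit. Qed.

Lemma tens_gact_bil (n : N) :
  is_bilinear (fun (h : H) (a' : A) => tens (h : RH) (gact a' n)).
Proof.
by have [Nl _] := gact_bil N; apply: (bilinear_comp (tens_bilinear _ _)
  (u := id) (v := fun a => gact a n) (w := id)).
Qed.

Lemma diag_act_coinv (b : A) (n : N) : coinvariant b ->
  diag_act b (tens (1 : RH) n) = tens (1 : RH) (gact b n).
Proof.
by rewrite diag_act_unit => ->; rewrite lift_tens //; apply: tens_gact_bil.
Qed.

Lemma diag_act_theta_unit h (n : N) :
  diag_act (theta h) (tens (1 : RH) n) =
  tens_lift (fun h1 h2 => tens (h1 : RH) (gact (theta h2) n)) (comult H h).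
Proof.
by rewrite diag_act_unit lift_coact_theta //; apply: tens_gact_bil.
Qed.

End UnitTensor.

Lemma coact_diag (a : A) : coact A a = diag_act a (tens (1 : RH) (1 : RA)).
Proof.
rewrite diag_act_unit {1}[coact A a]tens_lift_id.
by apply: eq_lift => h a' /=; rewrite mulr1.
Qed.

Lemma theta_coinv_proj (a : A) :
  tens_lift (fun h a' => theta h * p a') (coact A a) = a.
Proof.
have mr := (mul_bilinear A).2; have ml := (mul_bilinear A).1.
have tri : is_trilinear (fun h1 h2 (a' : A) => theta h1 * (theta (S h2) * a')).
  split=> [h a'|h a'|h h'].
  - exact: (lin_comp (ml _) theta_lin).
  - apply: (lin_comp (mr _)); exact: coinv_proj_bil.1.
  - apply: (lin_comp (mr _)); exact: mr.
rewrite -[RHS](coact_counit (X := id)) //.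
rewrite (eq_lift (h := fun h a' =>
  tens_lift (fun h2 a'' => theta h * (theta (S h2) * a'')) (coact A a'))).
  rewrite -(coact_coassoc _ tri); apply: eq_lift => h a'.
  rewrite -[_ *: a']mul1r -scalerAr scalerAl -theta_antipoder.
  rewrite (lift_comp _ _ (ml a')).
  by apply: eq_lift => h1 h2; rewrite mulrA.
by move=> h a'; rewrite /coinv_proj (lift_comp _ _ (mr _)).
Qed.

(* Convolution with theta is invertible, its inverse being convolution with
   the composite of theta and the antipode. *)
Lemma convolution_theta_inj (X : A -> tensor RH RA) : linear X ->
  (forall a, tens_lift (fun h a' =>
    diag_act (P := RH) (M := RA) (theta h) (X a')) (coact A a) = coact A a) ->
  forall a, X a = tens_lift (fun h a' =>
    diag_act (P := RH) (M := RA) (theta (S h)) (coact A a')) (coact A a).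
Proof.
move=> lX XE a; have [dl dr] := diag_act_bil RH RA.
have lsth := lin_comp theta_lin antipode_lin.
pose F h1 h2 (a' : A) :=
  diag_act (P := RH) (M := RA) (theta (S h1)) (diag_act (theta h2) (X a')).
have tri : is_trilinear F.
  split=> [h a'|h a'|h h'].
  - exact: (lin_comp (dl _) lsth).
  - apply: (lin_comp (dr _)); exact: (lin_comp (dl _) theta_lin).
  - by apply: (lin_comp (dr _)); apply: (lin_comp (dr _)).
rewrite (eq_lift (h := fun h a' => tens_lift (F h) (coact A a'))).
  rewrite -(coact_coassoc _ tri) -{1}[X a]coact_counit //.
  apply: eq_lift => h a'.
  rewrite -[X a' in LHS](@diag_act1 _ _ _ _ _ RH RA) -(fun_linZ (dl (X a'))).
  rewrite -theta_antipodel (lift_comp _ _ (dl (X a'))).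
  by apply: eq_lift => h1 h2; rewrite diag_actA.
by move=> h a'; rewrite -[in LHS]XE (lift_comp _ _ (dr _)).
Qed.

Lemma coinv_proj_coinv (a : A) : coinvariant (p a).
Proof.
have [dl dr] := diag_act_bil RH RA.
have mr := (mul_bilinear A).2; have ml := (mul_bilinear A).1.
rewrite /coinvariant coact_diag.
pose X1 a : tensor RH RA := diag_act (p a) (tens (1 : RH) (1 : RA)).
pose X2 a : tensor RH RA := tens 1 (p a).
rewrite -[LHS]/(X1 a) -[RHS]/(X2 a).
rewrite (@convolution_theta_inj X1) 1?[RHS](@convolution_theta_inj X2) //.
- exact: (lin_comp (tens_linr _) coinv_proj_lin).
- move=> {}a.
  pose F h1 h2 (a' : A) : tensor RH RA := tens h1 (theta h2 * p a').
  have tri : is_trilinear F.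
    split=> [h a'|h a'|h h'].
    + exact: tens_linl.
    + apply: (lin_comp (tens_linr _)); exact: (lin_comp (ml _) theta_lin).
    + apply: (lin_comp (tens_linr _)); exact: (lin_comp (mr _) coinv_proj_lin).
  rewrite (eq_lift (h := fun h a' =>
    tens_lift (fun h1 h2 => F h1 h2 a') (comult H h))).
    rewrite (coact_coassoc _ tri) [RHS]tens_lift_id; apply: eq_lift => h a'.
    by rewrite -(lift_comp _ _ (tens_linr h)) theta_coinv_proj.
  by move=> h a'; rewrite diag_act_theta_unit.
- exact: (lin_comp (dl _) coinv_proj_lin).
- move=> {}a; rewrite [RHS]coact_diag -[in RHS](theta_coinv_proj a).
  rewrite (lift_comp _ _ (dl _)).
  by apply: eq_lift => h a'; rewrite diag_actA.
Qed.

Lemma coinv_projMr (a b : A) : coinvariant b -> p (a * b) = p a * b.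
Proof.
move=> cb; have ml := (mul_bilinear A).1.
rewrite /coinv_proj [coact A (a * b)]coact_diag diag_actA -coact_diag cb.
rewrite (diag_act_unit (N := RA)) (lift_comp _ _ (lift_lin coinv_proj_bil)).
rewrite (lift_comp _ _ (ml b)); apply: eq_lift => h a'.
by rewrite lift_tens ?mulrA //; apply: coinv_proj_bil.
Qed.

Lemma coinv_proj_id (b : A) : coinvariant b -> p b = b.
Proof.
move=> cb; rewrite -[b in LHS]mul1r coinv_projMr //.
rewrite /coinv_proj coact1 lift_tens; last exact: coinv_proj_bil.
have := antipodel (1 : H); rewrite comult1 counit1 lift_tens => [|].
  by rewrite !mulr1 scale1r => ->; rewrite rmorph1 mul1r.
apply: (bilinear_comp (mul_bilinear H) (u := S) (v := id) (w := id)) => //.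
exact: antipode_lin.
Qed.

Lemma coinv_proj_theta h : p (theta h) = (hcounit h)%:A.
Proof.
rewrite /coinv_proj lift_coact_theta ?theta_antipodel //.
exact: coinv_proj_bil.
Qed.

Lemma coinv_proj_theta_mul h (a : A) :
  p (theta h * a) = hcounit h *: p a.
Proof.
have mr := (mul_bilinear A).2; have lp := coinv_proj_lin.
have pE (h' : H) (b : A) : coinvariant b -> p (theta h' * b) = hcounit h' *: b.
  by move=> cb; rewrite coinv_projMr // coinv_proj_theta -scalerAl mul1r.
rewrite -{1}[a]theta_coinv_proj (lift_comp _ _ (mr _)) (lift_comp _ _ lp).
rewrite -{2}[a](coact_counit (X := id)) // (lift_comp _ _ lp).
rewrite (lift_comp _ _ (lin_scale (hcounit h) (@lin_id _ _))).
apply: eq_lift => h' a'; rewrite mulrA -rmorphM pE; last exact: coinv_proj_coinv.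
by rewrite hcounitM (fun_linZ lp) scalerA.
Qed.

Section Commutative.
Hypothesis A_comm : colour_commutative chi A.
Hypothesis theta_graded : graded_map (@cdeg _ _ H) (@cdeg _ _ A) theta.

Lemma coinv_proj_mul_theta (a : A) h : p (a * theta h) = hcounit h *: p a.
Proof.
have [ml mr] := mul_bilinear A; have lp := coinv_proj_lin.
apply: (homog_lin_ext (f := fun h => p (a * theta h))
  (h := fun h => hcounit h *: p a) (cdeg_graded H).1) => [||g {}h Dh].
- apply: (lin_comp lp); exact: (lin_comp (mr _) theta_lin).
- exact: hcounit_scale_lin.
apply: (homog_lin_ext (f := fun a => p (a * theta h))
  (h := fun a => hcounit h *: p a) (cdeg_graded A).1) => [||g' {}a Da].
- apply: (lin_comp lp); exact: ml.
- exact: (lin_scale _ lp).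
rewrite (A_comm Da (theta_graded Dh)) (fun_linZ lp) coinv_proj_theta_mul.
have [->|g0] := eqVneq g 0; first by rewrite bich0r scale1r.
by rewrite (hcounit_deg Dh g0) !scale0r scaler0.
Qed.

Lemma coinv_projM (a b : A) : p (a * b) = p a * p b.
Proof.
have [ml mr] := mul_bilinear A; have lp := coinv_proj_lin.
rewrite -{1}[b]theta_coinv_proj (lift_comp _ _ (mr _)) (lift_comp _ _ lp).
rewrite -{2}[b](coact_counit (X := id)) // (lift_comp _ _ lp).
rewrite (lift_comp _ _ (mr (p a))); apply: eq_lift => h b'.
rewrite mulrA coinv_projMr; last exact: coinv_proj_coinv.
by rewrite coinv_proj_mul_theta (fun_linZ lp) -scalerAl scalerAr.
Qed.

Lemma coinv_proj_deg g (a : A) : cdeg g a -> cdeg g (p a).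
Proof.
move=> Da; have [Ag AZ] := cdeg_graded A.
have [_ coactD _ _] := coactP A; have [s [sP sE] sg] := coactD g a Da.
rewrite /coinv_proj sE (lift_sum coinv_proj_bil).
apply: (deg_sum Ag) => q qs _; rewrite -(sg q qs); have [Dh Db] := sP q qs.
by apply: cdegM => //; apply: theta_graded; apply: antipode_graded.
Qed.

End Commutative.

End Coinvariants.

(** * Syzygies up to projective modules *)

Section StableComparison.
Variables (G : zmodType) (k : fieldType) (A : colourAlgebra G k).

Definition short_exact (K P M : lmodType A) (i : K -> P) (f : P -> M) : Prop :=
  [/\ injective i, forall x, f x = 0 <-> exists y, i y = x & surj f].

(* X is a retract of Y up to maps that factor through a projective module. *)
Definition stable_le (X Y : lmodType A) : Prop :=
  exists (i : {linear X -> Y}) (r : {linear Y -> X}) (Q : lmodType A)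
         (a : {linear X -> Q}) (b : {linear Q -> X}),
    projective Q /\ forall x, r (i x) + b (a x) = x.

Lemma projective_stable_le (X Y : lmodType A) :
  projective Y -> stable_le X Y -> projective X.
Proof.
move=> projY [i [r [Q [a [b [projQ E]]]]]] M N f g f_surj.
have [h hE] := projY M N f (g \o r) f_surj.
have [h' hE'] := projQ M N f (g \o b) f_surj.
exists ((h \o i) \+ (h' \o a)) => x.
by rewrite /= linearD hE hE' /= -linearD E.
Qed.

Lemma projective_retract (X Y : lmodType A) (s : {linear X -> Y})
    (r : {linear Y -> X}) : projective Y -> cancel s r -> projective X.
Proof.
move=> projY sK M N f g f_surj; have [h hE] := projY M N f (g \o r) f_surj.
by exists (h \o s) => x; rewrite /= hE /= sK.
Qed.

Lemma factor_exact (K P M Z : lmodType A) (i : {linear K -> P})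
    (f : {linear P -> M}) (g : {linear Z -> P}) :
  short_exact i f -> (forall z, f (g z) = 0) ->
  exists h : {linear Z -> K}, forall z, i (h z) = g z.
Proof.
case=> i_inj ex _ fg0.
have hP z : exists y, i y = g z by apply: (ex _).1.
pose h z := projT1 (cid (hP z)).
have hE z : i (h z) = g z by rewrite /h; case: cid.
have lh : linear h by move=> a x y; apply: i_inj; rewrite !(linearP, hE).
by exists (mk_linear lh).
Qed.

Lemma stable_le_syzygy (K P Y L F X : lmodType A)
    (i : {linear K -> P}) (f : {linear P -> Y})
    (j : {linear L -> F}) (e : {linear F -> X}) :
  short_exact i f -> projective P -> short_exact j e -> projective F ->
  stable_le X Y -> stable_le L K.
Proof.
move=> exP projP exF projF [u [r [Q [a [b [projQ E]]]]]].
have [_ kerf f_surj] := exP; have [j_inj kere e_surj] := exF.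
have [I IE] := projF P Y f (u \o e) f_surj.
have [R RE] := projP F X e (r \o f) e_surj.
have [b' b'E] := projQ F X e b e_surj.
have ej0 l : e (j l) = 0 by apply: (kere _).2; exists l.
have fi0 x : f (i x) = 0 by apply: (kerf _).2; exists x.
have [I' I'E] : exists h : {linear L -> K}, forall l, i (h l) = (I \o j) l.
  by apply: (factor_exact exP) => l; rewrite IE /= ej0 linear0.
have [R' R'E] : exists h : {linear K -> L}, forall x, j (h x) = (R \o i) x.
  by apply: (factor_exact exF) => l; rewrite RE /= fi0 linear0.
pose psi : {linear F -> F} := (idfun \- (R \o I)) \- (b' \o a \o e).
have [psi' psi'E] : exists h : {linear F -> L}, forall z, j (h z) = psi z.
  apply: (factor_exact exF) => z; rewrite /= !linearB RE b'E /= IE /=.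
  by rewrite -{1}[e z]E addrAC addrK subrr.
exists I', R', F, j, psi'; split=> // l; apply: j_inj.
rewrite linearD R'E psi'E /= I'E /= ej0 !linear0 addr0.
by rewrite addrC subrK.
Qed.

Lemma projective_resolution0 (M : lmodType A) :
  projective_resolution 0 M -> projective M.
Proof.
case=> P [d [eps [projP [eps_surj ker_eps _ P0]]]].
pose s m := projT1 (cid (eps_surj m)).
have sK m : eps (s m) = m by rewrite /s; case: cid.
have eps_inj : injective eps.
  move=> x y exy; apply/eqP; rewrite -subr_eq0; apply/eqP.
  have [|z <-] := (ker_eps (x - y)).1; first by rewrite linearB exy subrr.
  by rewrite (P0 1%N isT z) linear0.
have ls : linear s by move=> a x y; apply: eps_inj; rewrite !(linearP, sK).
exact: (projective_retract (s := mk_linear ls) (projP 0%N)).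
Qed.

Lemma projective_resolutionS n (M : lmodType A) :
  projective_resolution n.+1 M ->
  exists (K P : lmodType A) (i : {linear K -> P}) (f : {linear P -> M}),
    [/\ projective P, short_exact i f & projective_resolution n K].
Proof.
case=> P [d [eps [projP [eps_surj ker_eps kerd P0]]]].
pose i : {linear kernel eps -> P 0%N} := mk_linear (@kval_lin _ _ _ eps).
have ex : short_exact i eps.
  split=> //; first exact: kval_inj.
  move=> x; split=> [x0|[y <-]]; last exact: kernelE.
  by exists (to_kernel x0).
exists (kernel eps), (P 0%N), i, eps; split=> //.
have [eps' eps'E] : exists h : {linear P 1%N -> kernel eps},
    forall z, i (h z) = d 0%N z.
  by apply: (factor_exact ex) => z; apply: (ker_eps _).2; exists z.
exists (fun i => P i.+1), (fun i => d i.+1), eps'; split=> //; split.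
- move=> x; have [z zE] := (ker_eps _).1 (kernelE x).
  by exists z; apply: kval_inj; rewrite -zE -eps'E.
- move=> x; rewrite -(kerd 0%N) -eps'E; split=> [->|E]; first exact: linear0.
  by apply: kval_inj; rewrite (fun_lin0 (@kval_lin _ _ _ eps)) -E.
- by move=> m; apply: kerd.
- by move=> m nm; apply: P0.
Qed.

End StableComparison.

(** * Graded modules as modules *)

Section ModuleConversions.
Variables (G : zmodType) (k : fieldType) (A : colourAlgebra G k).

Definition module_of (X : gmodule A) : Type := gcar X.
HB.instance Definition _ (X : gmodule A) :=
  GRing.Zmodule.copy (module_of X) (gcar X).

Section ModuleOf.
Variable X : gmodule A.

Lemma module_of_scaleDr : right_distributive (@gact _ _ _ X) +%R.
Proof. by move=> a; apply: fun_linD; case: (gact_bil X). Qed.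

Lemma module_of_scaleDl (x : X) : {morph (@gact _ _ _ X)^~ x : a b / a + b}.
Proof. by apply: (fun_linD (f := fun a => gact a x)); case: (gact_bil X). Qed.

HB.instance Definition _ := GRing.Zmodule_isLmodule.Build A (module_of X)
  (fun a b x => esym (gactA a b x)) (@gact1 _ _ _ X) module_of_scaleDr
  module_of_scaleDl.

Lemma module_of_scaleE (a : A) (x : X) : a *: (x : module_of X) = gact a x.
Proof. by []. Qed.

Definition graded_of : gradedModule A :=
  @GradedModule G k A (module_of X) (@gdeg _ _ _ X) (gdegP X).1
    (@gact_deg _ _ _ X).

End ModuleOf.

Lemma gact_scalar (X : gmodule A) (c : k) (x : X) : gact c%:A x = c *: x.
Proof.
have [gl _] := gact_bil X.
by rewrite (fun_linZ (f := fun a => gact a x) (gl x)) gact1.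
Qed.

Definition scalars_of (M : lmodType A) : Type := M.
HB.instance Definition _ (M : lmodType A) :=
  GRing.Zmodule.copy (scalars_of M) M.

Section ScalarsOf.
Variable M : lmodType A.

Definition scalars_scale (c : k) (m : scalars_of M) : scalars_of M :=
  (c%:A : A) *: (m : M).

Lemma scalars_scaleA a b m :
  scalars_scale a (scalars_scale b m) = scalars_scale (a * b) m.
Proof. by rewrite /scalars_scale scalerA -scalerAl mul1r scalerA. Qed.

Lemma scalars_scale1 : left_id 1 scalars_scale.
Proof. by move=> m; rewrite /scalars_scale !scale1r. Qed.

Lemma scalars_scaleDr : right_distributive scalars_scale +%R.
Proof. by move=> a x y; rewrite /scalars_scale scalerDr. Qed.

Lemma scalars_scaleDl m : {morph scalars_scale^~ m : a b / a + b}.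
Proof. by move=> a b; rewrite /scalars_scale !scalerDl. Qed.

HB.instance Definition _ := GRing.Zmodule_isLmodule.Build k (scalars_of M)
  scalars_scaleA scalars_scale1 scalars_scaleDr scalars_scaleDl.

Lemma scalars_scaleE (c : k) (m : M) : c *: (m : scalars_of M) = (c%:A : A) *: m.
Proof. by []. Qed.

Lemma scalars_act_bil :
  is_bilinear (fun (a : A) (m : scalars_of M) => (a *: (m : M) : scalars_of M)).
Proof.
split=> [m|a] c x y.
  by rewrite scalars_scaleE /= scalerDl scalerA -scalerAl mul1r.
by rewrite !scalars_scaleE /= scalerDr !scalerA -scalerAl -scalerAr mul1r mulr1.
Qed.

End ScalarsOf.

Section OfGraded.
Variable M : gradedModule A.

Lemma scalars_graded : @is_graded_space G k (scalars_of M) (@mdeg _ _ _ M).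
Proof.
split; first exact: mdeg_grading.
move=> g c m Dm; rewrite scalars_scaleE -[g]add0r; apply: mdegZ => //.
by case: (cdeg_graded A) => _; apply; apply: cdeg1.
Qed.

Definition gmodule_of : gmodule A :=
  @GModule G k A (scalars_of M) (@mdeg _ _ _ M) scalars_graded _
    (scalars_act_bil M) (fun a b m => esym (scalerA a b m)) (@scale1r _ M)
    (@mdegZ _ _ _ M).

End OfGraded.

Lemma graded_projective_of (P : gradedModule A) :
  projective P -> graded_projective P.
Proof.
move=> projP M N f g fD gD f_surj; have [h hE] := projP M N f g f_surj.
have [Pg Mg] := (mdeg_grading P, mdeg_grading M).
pose phi d x := hcomp (@mdeg _ _ _ M) d (h x).
have phiD d : {morph phi d : x y / x + y}.
  by move=> x y; rewrite /phi linearD hcompD.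
pose h0 := hext (@mdeg _ _ _ P) phi.
have h0D : {morph h0 : x y / x + y} := hextD Pg phiD.
have h0_deg d x : mdeg d x -> h0 x = phi d x by apply: hext_deg.
have h00 : h0 0 = 0 by apply: (addIr (h0 0)); rewrite -h0D !add0r.
have h0_lin : linear h0.
  move=> a x y; rewrite h0D; congr (_ + _).
  elim/(homog_ind Pg): x => [|x z Hx Hz|d x Dx].
  - by rewrite scaler0 h00 scaler0.
  - by rewrite scalerDr !h0D Hx Hz scalerDr.
  elim/(homog_ind (cdeg_graded A).1): a => [|a b Ha Hb|e a Da].
  - by rewrite !scale0r h00.
  - by rewrite !scalerDl h0D Ha Hb.
  rewrite (h0_deg _ _ (mdegZ Da Dx)) (h0_deg _ _ Dx) /phi linearZ_LR.
  elim/(homog_ind Mg): (h x) => [|u v Hu Hv|d' u Du].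
  - by rewrite scaler0 !(hcomp0 Mg) scaler0.
  - by rewrite scalerDr !hcompD // Hu Hv scalerDr.
  have [<-|neq] := eqVneq d' d.
    by rewrite !hcomp_id //; apply: mdegZ.
  rewrite (hcomp_neq Mg Du) 1?eq_sym // scaler0.
  apply: (hcomp_neq Mg (mdegZ Da Du)).
  by rewrite (inj_eq (addrI e)) eq_sym.
exists (mk_linear h0_lin); split=> [d x Dx|x].
  by rewrite /= (h0_deg _ _ Dx); apply: hcomp_deg.
elim/(homog_ind Pg): x => [|x z Hx Hz|d x Dx]; first by rewrite !linear0.
  by rewrite !linearD Hx Hz.
rewrite /= (h0_deg _ _ Dx) /phi.
have Ng := mdeg_grading N.
rewrite -[RHS](hcomp_id Ng (gD d x Dx)) -hE.
elim/(homog_ind Mg): (h x) => [|u v Hu Hv|d' u Du].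
- by rewrite hcomp0 // !linear0 hcomp0.
- by rewrite linearD !hcompD // linearD Hu Hv.
have [<-|neq] := eqVneq d' d; first by rewrite !hcomp_id //; apply: fD.
by rewrite !(hcomp_neq _ (g := d')) ?linear0 // 1?eq_sym //; apply: fD.
Qed.

End ModuleConversions.

Lemma graded_hcomp (G V W : zmodType) (DV : G -> V -> Prop) (DW : G -> W -> Prop)
    (f : V -> W) g v :
  is_grading DV -> is_grading DW -> {morph f : x y / x + y} ->
  graded_map DV DW f -> f (hcomp DV g v) = hcomp DW g (f v).
Proof.
move=> DVg DWg fD fg.
have f0 : f 0 = 0 by apply: (addIr (f 0)); rewrite -fD !add0r.
elim/(homog_ind DVg): v => [|x y Hx Hy|d x Dx].
- by rewrite hcomp0 // f0 hcomp0.
- by rewrite hcompD // !fD hcompD // Hx Hy.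
have [<-|neq] := eqVneq d g; first by rewrite !hcomp_id //; apply: fg.
by rewrite (hcomp_neq DVg Dx) 1?eq_sym // (hcomp_neq DWg (fg _ _ Dx)) 1?eq_sym.
Qed.

Lemma kernel_graded (G : zmodType) (k : fieldType) (V W : lmodType k)
    (D : G -> V -> Prop) (f : {linear V -> W}) : is_graded_space D ->
  (forall g v, f v = 0 -> f (hcomp D g v) = 0) ->
  is_graded_space (fun g (x : kernel f) => D g (kval x)).
Proof.
move=> [Dg DZ] f_hcomp; have lv := @kval_lin _ _ _ f.
split=> [|g a x Dx]; last by rewrite (fun_linZ lv); apply: DZ.
split.
- by move=> g; rewrite (fun_lin0 lv); apply: deg0.
- by move=> g x y; rewrite (fun_linB lv); apply: degB.
- move=> x; have f0 g := f_hcomp g _ (kernelE x).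
  exists (supp D (kval x)), (fun g => to_kernel (f0 g)).
  split; [exact: supp_uniq | by move=> g; apply: hcomp_deg |].
  by apply: kval_inj; rewrite (fun_lin_sum lv) /= -(hcomp_sum Dg).
- move=> s F us FD /(congr1 (@kval _ _ _ f)).
  rewrite (fun_lin_sum lv) (fun_lin0 lv) => F0 g gs; apply: kval_inj.
  rewrite [RHS](fun_lin0 lv); move: g gs; case: Dg => _ _ _ indep.
  exact: indep us FD F0.
Qed.

(** * Lifting linear maps over the coinvariants *)

Section CoinvariantSubring.
Variables (G : zmodType) (k : fieldType) (chi : bicharacter G k).
Variables (H : colourHopfAlgebra chi) (A : comoduleColourAlgebra H).

Lemma coinv_lin (a b c : A) : coinvariant b -> coinvariant c ->
  forall x : k, coinvariant (x *: b + c).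
Proof.
move=> cb cc x; rewrite /coinvariant linearP cb cc.
by rewrite (tens_linr (1 : H) x b c).
Qed.

Lemma coinv0 : coinvariant (0 : A).
Proof. by rewrite /coinvariant linear0 (fun_lin0 (tens_linr _)). Qed.

Lemma coinv1 : coinvariant (1 : A).
Proof. exact: coact1. Qed.

Lemma coinvD (b c : A) : coinvariant b -> coinvariant c -> coinvariant (b + c).
Proof. by move=> cb cc; rewrite -[b]scale1r; apply: coinv_lin. Qed.

Lemma coinvZ x (b : A) : coinvariant b -> coinvariant (x *: b).
Proof.
by move=> cb; rewrite -[x *: b]addr0; apply: coinv_lin => //; apply: coinv0.
Qed.

Lemma coinvM (b c : A) : coinvariant b -> coinvariant c -> coinvariant (b * c).
Proof.
move=> cb cc; rewrite /coinvariant coact_diag diag_actA -coact_diag cc.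
by rewrite (diag_act_coinv (N := regular_gmodule A)).
Qed.

Lemma coinv_hcomp g (b : A) :
  coinvariant b -> coinvariant (hcomp (@cdeg _ _ A) g b).
Proof.
move=> cb; have Tg := tens_graded (cdeg_graded H) (cdeg_graded A).
have [_ coactD _ _] := coactP A; have [Ag _] := cdeg_graded A.
rewrite /coinvariant.
rewrite (graded_hcomp (DW := tens_deg (@cdeg _ _ H) (@cdeg _ _ A))
  (f := coact A) _ _ Ag Tg.1) ?cb //; last exact: linearD.
rewrite (graded_hcomp (f := tens (1 : H)) _ _ Ag Tg.1) //.
  exact: fun_linD (tens_linr _).
by move=> d a Da; rewrite -[d]add0r; apply: tens_deg_tens => //; apply: cdeg1.
Qed.

End CoinvariantSubring.

Section CoinvariantLifting.
Variables (G : zmodType) (k : fieldType) (chi : bicharacter G k).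
Variables (H : colourHopfAlgebra chi) (A : comoduleColourAlgebra H).
Hypothesis A_div : coinvariants_division_ring A.
Variables (N : gmodule A) (X Y : lmodType A).
Variables (f : {linear X -> Y}) (g : N -> Y).
Hypothesis f_surj : surj f.
Hypothesis gP : forall b m n, coinvariant b ->
  g (gact b m + n) = b *: g m + g n.
Local Notation D := (@gdeg _ _ _ N).

(* Graph of a lift of g along f, defined on a graded B-submodule of N. *)
Record partial_lift (L : N * X -> Prop) : Prop := PartialLift {
  plift0 : L (0, 0);
  pliftP : forall b s t, coinvariant b -> L s -> L t ->
    L (gact b s.1 + t.1, b *: s.2 + t.2);
  plift_fun : forall x, L (0, x) -> x = 0;
  plift_lift : forall n x, L (n, x) -> f x = g n;
  plift_graded : forall n x, L (n, x) -> forall d, exists y, L (hcomp D d n, y)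
}.

Lemma hcomp_gact d e (b : A) (n : N) : D e n ->
  hcomp D (d + e) (gact b n) = gact (hcomp (@cdeg _ _ A) d b) n.
Proof.
move=> Dn; have [Ng _] := gdegP N; have [Ag _] := cdeg_graded A.
have [gl _] := gact_bil N.
apply: (homog_lin_ext (f := fun b => hcomp D (d + e) (gact b n))
  (h := fun b => gact (hcomp (@cdeg _ _ A) d b) n) Ag) => [||d' {}b Db].
- exact: (lin_comp (hcomp_lin (gdegP N) _) (gl n)).
- exact: (lin_comp (gl n) (hcomp_lin (cdeg_graded A) _)).
have [<-|neq] := eqVneq d' d; first by rewrite !hcomp_id //; apply: gact_deg.
rewrite (hcomp_neq Ag Db) 1?eq_sym // (fun_lin0 (gl n)).
by rewrite (hcomp_neq Ng (gact_deg Db Dn)) // (inj_eq (addIr e)) eq_sym.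
Qed.

Lemma lifted_map0 : g 0 = 0.
Proof.
have := gP 0 0 (coinv1 A); rewrite gact1 addr0 scale1r => /eqP.
by rewrite -{1}[g 0]addr0 (inj_eq (addrI _)) eq_sym => /eqP.
Qed.

Lemma partial_lift_bigcup (F : (N * X -> Prop) -> Prop) :
  (forall L, F L -> partial_lift L) ->
  (forall L L', F L -> F L' ->
     (forall z, L z -> L' z) \/ (forall z, L' z -> L z)) ->
  (exists L, F L) -> partial_lift (fun z => exists2 L, F L & L z).
Proof.
move=> FP Ftot [L0 FL0]; split.
- by exists L0 => //; apply: plift0 (FP _ FL0).
- move=> b s t cb [L1 F1 Ls] [L2 F2 Lt].
  have [L12|L21] := Ftot _ _ F1 F2.
    by exists L2 => //; apply: (pliftP (FP _ F2)) => //; apply: L12.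
  by exists L1 => //; apply: (pliftP (FP _ F1)) => //; apply: L21.
- by move=> x [L FL Lx]; apply: plift_fun (FP _ FL) _ Lx.
- by move=> n x [L FL Lx]; apply: plift_lift (FP _ FL) _ _ Lx.
- move=> n x [L FL Lx] d; have [y Ly] := plift_graded (FP _ FL) Lx d.
  by exists y; exists L.
Qed.

Lemma partial_lift_extend (L : N * X -> Prop) (e : G) (n0 : N) :
  partial_lift L -> D e n0 -> (forall x, ~ L (n0, x)) ->
  exists L', [/\ partial_lift L', forall z, L z -> L' z & exists y, L' (n0, y)].
Proof.
move=> LP Dn0 n0L; have [y0 fy0] := f_surj (g n0).
have [L0 LD Lfun Llift Lgr] := LP.
have [gl gr] := gact_bil N; have [Ng _] := gdegP N.
have gactD (b c : A) (n : N) : gact (b + c) n = gact b n + gact c n.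
  exact: (fun_linD (f := fun a => gact a n) (gl n)).
have gact0 (n : N) : gact 0 n = 0 := fun_lin0 (f := fun a => gact a n) (gl n).
have indep b x : coinvariant b -> L (gact b n0, x) -> b = 0.
  move=> cb Lx; rewrite (hcomp_sum (cdeg_graded A).1 b) big1 // => d _.
  apply: contrapT => /eqP bd0.
  have cbd := coinv_hcomp d cb.
  have [b' [cb' _ b'b]] := A_div cbd (hcomp_deg (cdeg_graded A).1 d b) bd0.
  have [y] := Lgr _ _ Lx (d + e); rewrite (hcomp_gact d b Dn0) => Ly.
  have := LD _ _ _ cb' Ly L0; rewrite /= -gactA b'b gact1 addr0.
  exact: n0L.
exists (fun z => exists s b, [/\ L s, coinvariant b &
  z = (s.1 + gact b n0, s.2 + b *: y0)]); split; last first.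
- exists y0; exists (0, 0), 1; split=> //; first exact: coinv1.
  by rewrite gact1 scale1r !add0r.
- move=> [n x] Lz; exists (n, x), 0; split=> //; first exact: coinv0.
  by rewrite gact0 scale0r !addr0.
split.
- exists (0, 0), 0; split=> //; first exact: coinv0.
  by rewrite gact0 scale0r !addr0.
- move=> c _ _ cc [s [b [Ls cb ->]]] [s' [b' [Ls' cb' ->]]].
  exists (gact c s.1 + s'.1, c *: s.2 + s'.2), (c * b + b'); split.
  + exact: LD.
  + by apply: coinvD => //; apply: coinvM.
  + by rewrite /= (fun_linD (gr c)) scalerDr gactD scalerDl gactA scalerA;
      congr (_, _); rewrite addrACA.
- move=> x [s [b [Ls cb [/esym/eqP]]]].
  rewrite addrC addr_eq0 => /eqP bn0 ->.
  have Lb : L (gact b n0, - s.2).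
    have := LD _ _ _ (coinvZ (- 1) (coinv1 A)) Ls L0.
    rewrite /= gact_scalar !addr0 scaleN1r -bn0 scaleN1r => Lb.
    by rewrite -scaleN1r.
  have b0 := indep _ _ cb Lb; move: Lb; rewrite b0 gact0 => /Lfun.
  by rewrite scale0r addr0 => /eqP; rewrite oppr_eq0 => /eqP.
- move=> n x [s [b [Ls cb [-> ->]]]].
  have s12 : L (s.1, s.2) by case: s Ls.
  by rewrite linearD linearZ /= (Llift _ _ s12) fy0 [s.1 + _]addrC gP // addrC.
- move=> n x [s [b [Ls cb [-> _]]]] d.
  have s12 : L (s.1, s.2) by case: s Ls.
  have [y Ly] := Lgr _ _ s12 d.
  pose b' := hcomp (@cdeg _ _ A) (d - e) b.
  exists (y + b' *: y0), (hcomp D d s.1, y), b'; split=> //.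
    exact: coinv_hcomp.
  by rewrite hcompD // /b' -(hcomp_gact _ _ Dn0) subrK.
Qed.

Lemma coinvariant_lift : exists l : N -> X,
  (forall b m n, coinvariant b -> l (gact b m + n) = b *: l m + l n) /\
  (forall n, f (l n) = g n).
Proof.
have [Ng _] := gdegP N.
pose P (L : N * X -> Prop) := (exists z, L z) -> partial_lift L.
have [F FP Ftot|L [PL Lmax]] := @classical_sets.Zorn_bigcup _ P.
  case=> z [L0 FL0 L0z].
  pose F' L := F L /\ exists z, L z.
  have F'P L : F' L -> partial_lift L by case=> /FP; apply.
  have E : (fun z => exists2 L, F' L & L z) = classical_sets.bigcup F id.
    apply/funext => z'; apply/propext; split=> [[L [FL _] Lz]|[L FL Lz]].
      by exists L.
    by exists L => //; split=> //; exists z'.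
  rewrite -E; apply: partial_lift_bigcup => //.
    by move=> L L' [FL _] [FL' _]; apply: Ftot.
  by exists L0; split=> //; exists z.
have {Lmax}Lmax L' : partial_lift L' -> (forall z, L z -> L' z) ->
    forall z, L' z -> L z.
  move=> L'P LL' z L'z; apply: contrapT => nLz; apply: (Lmax L'); last by [].
  by split=> // /(_ z L'z).
have LP : partial_lift L.
  apply: PL; apply: contrapT => noz.
  have L'P : partial_lift (fun z => z = (0, 0)).
    split=> //.
    - move=> b _ _ _ -> -> /=.
      by rewrite scaler0 (fun_lin0 ((gact_bil N).2 b)) !addr0.
    - by move=> x [].
    - by move=> n x [-> ->]; rewrite linear0 lifted_map0.
    - by move=> n x [-> _] d; exists 0; rewrite hcomp0.
  apply: (noz); exists (0, 0); apply: (Lmax _ L'P) => // z Lz.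
  by case: noz; exists z.
have [L0 LD Lfun Llift Lgr] := LP.
have dom_homog e n : D e n -> exists x, L (n, x).
  move=> Dn; apply: contrapT => nL.
  have [|L' [L'P LL' [y L'y]]] := partial_lift_extend LP Dn.
    by move=> x Lx; apply: nL; exists x.
  by apply: nL; exists y; apply: (Lmax L').
have dom n : exists x, L (n, x).
  elim/(homog_ind Ng): n => [|m n [x Lx] [y Ly]|//]; first by exists 0.
  exists (1 *: x + y); have := LD _ _ _ (coinv1 A) Lx Ly.
  by rewrite /= gact1.
pose l n := projT1 (cid (dom n)).
have lP n : L (n, l n) by rewrite /l; case: cid.
have Lu n x y : L (n, x) -> L (n, y) -> x = y.
  move=> Lx Ly; apply/eqP; rewrite -subr_eq0; apply/eqP; apply: Lfun.
  have := LD _ _ _ (coinvZ (- 1) (coinv1 A)) Ly Lx.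
  by rewrite /= gact_scalar !scaleN1r addNr addrC.
exists l; split=> [b m n cb|n]; last exact: Llift (lP n).
by apply: Lu (lP _) _; apply: (LD _ _ _ cb (lP m) (lP n)).
Qed.

End CoinvariantLifting.

(** * The canonical projective cover and its kernel *)

Section CanonicalCover.
Variables (G : zmodType) (k : fieldType) (chi : bicharacter G k).
Variables (H : colourHopfAlgebra chi) (A : comoduleColourAlgebra H).
Variable theta : {lrmorphism H -> A}.
Hypothesis theta_colinear : colinear_from_hopf theta.
Local Notation S := (antipode H).
Local Notation RH := (regular_gmodule H).
Local Notation p := (coinv_proj theta).

Definition cover (N : gmodule A) : gmodule A := diag_gmodule RH N.

Section Cover.
Variable N : gmodule A.
Local Notation unit_tens := (fun n : N => tens (1 : RH) n).

Lemma act_theta_antipode_lin (n : N) : linear (fun h => gact (theta (S h)) n).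
Proof.
apply: (lin_comp ((gact_bil N).1 n) (g := fun h => theta (S h))).
exact: (lin_comp (theta_lin theta) (@antipode_lin _ _ _ H)).
Qed.

Lemma tens_as_diag h (n : N) :
  tens (h : RH) n = tens_lift (fun h1 h2 =>
    diag_act (theta h1) (unit_tens (gact (theta (S h2)) n))) (comult H h).
Proof.
have [gl gr] := gact_bil N; have tr := @tens_linr k RH N.
pose F h1 h2 h3 : tensor RH N :=
  tens (h1 : RH) (gact (theta h2) (gact (theta (S h3)) n)).
have tri : is_trilinear F.
  split=> [x y|x y|x y]; first exact: tens_linl.
    apply: (lin_comp (tr x)); exact: (lin_comp (gl _) (theta_lin theta)).
  apply: (lin_comp (tr x)); apply: (lin_comp (gr _)).
  exact: act_theta_antipode_lin.
rewrite (eq_lift (h := fun h1 h2 =>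
  tens_lift (fun h1' h1'' => F h1' h1'' h2) (comult H h1))); last first.
  by move=> h1 h2; rewrite diag_act_theta_unit.
rewrite (comult_coassoc _ tri).
rewrite (eq_lift (h := fun h1 h2 => tens (hcounit h2 *: (h1 : RH)) n)).
  rewrite -(lift_comp (fun h1 h2 => hcounit h2 *: (h1 : RH)) _
    (@tens_linl k RH N n)).
  congr (tens _ n); exact: esym (counitr h).
move=> h1 h2; rewrite (fun_linZ (@tens_linl k RH N n)) -(fun_linZ (tr h1)).
rewrite -gact_scalar -(theta_antipoder theta) (lift_comp _ _ (gl n)).
rewrite (lift_comp _ _ (tr h1)); apply: eq_lift => x y.
by rewrite /F gactA.
Qed.

Definition cover_map : cover N -> N := tens_lift (fun h n => hcounit h *: n).

Lemma cover_map_bil : is_bilinear (fun (h : RH) (n : N) => hcounit h *: n).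
Proof.
split=> [n|h]; first exact: hcounit_scale_lin.
exact: (lin_scale _ (@lin_id _ _)).
Qed.

Lemma cover_map_klin : linear cover_map.
Proof. exact/lift_lin/cover_map_bil. Qed.

Lemma cover_map_unit n : cover_map (unit_tens n) = n.
Proof.
rewrite /cover_map lift_tens; last exact: cover_map_bil.
by rewrite (_ : hcounit (1 : H) = 1) ?scale1r //; apply: counit1.
Qed.

Lemma cover_map_diag_unit (a : A) n :
  cover_map (diag_act a (unit_tens n)) = gact a n.
Proof.
rewrite diag_act_unit (lift_comp _ _ cover_map_klin).
rewrite -[RHS](coact_counit _ ((gact_bil N).1 n)); apply: eq_lift => h a'.
by rewrite /cover_map lift_tens //; apply: cover_map_bil.
Qed.

Lemma cover_map_act (a : A) z : cover_map (gact a z) = gact a (cover_map z).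
Proof.
have [gl gr] := gact_bil N; have [dl dr] := diag_act_bil RH N.
apply: (tens_lin_ext (lin_comp cover_map_klin (dr a))
  (lin_comp (gr a) cover_map_klin)) => h n /=.
rewrite {}tens_as_diag (lift_comp _ _ (dr a)) !(lift_comp _ _ cover_map_klin).
rewrite (lift_comp _ _ (gr a)); apply: eq_lift => h1 h2.
by rewrite -diag_actA !cover_map_diag_unit gactA.
Qed.

Lemma cover_map_deg : graded_map (@gdeg _ _ _ (cover N)) (@gdeg _ _ _ N) cover_map.
Proof.
move=> g z; have [Ng NZ] := gdegP N.
elim/tens_deg_ind: z / => [|x y|h h' m n Dm Dn <-].
- by rewrite (fun_lin0 cover_map_klin); apply: deg0.
- by rewrite (fun_linD cover_map_klin); apply: degD.
rewrite /cover_map lift_tens; last exact: cover_map_bil.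
have [->|h0] := eqVneq h 0; first by rewrite add0r; apply: NZ.
by rewrite (hcounit_deg Dm h0) scale0r; apply: deg0.
Qed.

Hypothesis A_div : coinvariants_division_ring A.

(* A B-linear lift l on N extends to the cover by
   h (x) n |-> theta(h_1) l(S(h_2) n), and the cover is spanned by the elements
   a (1 (x) n), on which this extension takes the value a l(n). *)
Lemma cover_projective : projective (module_of (cover N)).
Proof.
move=> X Y f g f_surj; have [gl gr] := gact_bil N.
have [|l [lP lE]] := coinvariant_lift A_div (N := N)
    (g := fun n => g (unit_tens n)) f_surj.
  move=> b m n cb; rewrite (fun_linD (@tens_linr k RH N 1)) linearD.
  by rewrite -diag_act_coinv // -linearZ.
have l_lin : linear (l : N -> scalars_of X).
  by move=> c m n; rewrite -gact_scalar lP //; apply/coinvZ/coinv1.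
have [sl sr] := scalars_act_bil X.
pose F (n : N) h1 h2 : scalars_of X :=
  theta h1 *: (l (gact (theta (S h2)) n) : X).
have F_tri : is_trilinear (fun h1 h2 n => F n h1 h2).
  split=> [h2 n|h1 n|h1 h2].
  - apply: (lin_comp (sl _)); exact: theta_lin.
  - apply: (lin_comp (sr (theta h1))); apply: (lin_comp l_lin).
    exact: act_theta_antipode_lin.
  - by apply: (lin_comp (sr (theta h1))); apply: (lin_comp l_lin).
have F_bil n : is_bilinear (F n).
  by have [F1 F2 _] := F_tri; split=> x; [apply: F1 | apply: F2].
pose E (h : RH) (n : N) : scalars_of X := tens_lift (F n) (comult H h).
have E_bil : is_bilinear E.
  split=> [n|h].
    by apply: (lin_comp (lift_lin (F_bil n))); apply: linearP.
  by apply: lift_param => h1 h2; case: F_tri => _ _; apply.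
pose h : cover N -> scalars_of X := tens_lift E.
have h_lin : linear h := lift_lin E_bil.
have h_unit (a : A) n : h (diag_act a (unit_tens n)) = a *: (l n : X).
  rewrite diag_act_unit (lift_comp _ _ h_lin).
  pose F' h1 h2 (a' : A) := F (gact a' n) h1 h2.
  have F'_tri : is_trilinear F'.
    have [F1 F2 F3] := F_tri; split=> [x y|x y|x y]; [exact: F1|exact: F2|].
    exact: (lin_comp (F3 x y) (gl n)).
  rewrite (eq_lift (h := fun h a' =>
    tens_lift (fun h1 h2 => F' h1 h2 a') (comult H h))); last first.
    by move=> x a'; rewrite /h lift_tens.
  rewrite (coact_coassoc _ F'_tri).
  have ln := lin_comp l_lin (gl n).
  have sln := sl (l n).
  rewrite -{2}[a](theta_coinv_proj theta) (lift_comp _ _ sln).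
  apply: eq_lift => x a'.
  have -> : theta x * p a' *: (l n : X) = theta x *: (l (gact (p a') n) : X).
    have := lP (p a') n 0 (coinv_proj_coinv theta_colinear a').
    rewrite (fun_lin0 l_lin) !addr0 => ->; exact: esym (scalerA _ _ _).
  rewrite (lift_comp _ _ ln) (lift_comp _ _ (sr (theta x))).
  by apply: eq_lift => y a''; rewrite /F' /F gactA.
have h_tens x n : h (tens (x : RH) n) =
    tens_lift (fun h1 h2 => h (diag_act (theta h1)
      (unit_tens (gact (theta (S h2)) n)))) (comult H x).
  by rewrite {1}tens_as_diag (lift_comp _ _ h_lin).
have [dl dr] := diag_act_bil RH N.
have h_act (a : A) z : h (diag_act a z) = a *: (h z : X).
  apply: (tens_lin_ext (lin_comp h_lin (dr a)) (lin_comp (sr a) h_lin)) => x n /=.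
  rewrite h_tens tens_as_diag (lift_comp _ _ (dr a)) (lift_comp _ _ h_lin).
  rewrite (lift_comp _ _ (sr a)); apply: eq_lift => h1 h2.
  by rewrite -diag_actA !h_unit scalerA.
have hA_lin : @GRing.linear_for A (module_of (cover N)) X *:%R h.
  move=> a x y; rewrite -[RHS]/((a *: (h x : X) : scalars_of X) + h y) -h_act.
  exact: fun_linD h_lin _ _.
exists (mk_linear hA_lin) => z /=.
have g_lin : linear (g : tensor RH N -> scalars_of Y).
  move=> c x y; rewrite linearD; congr (_ + _).
  by rewrite scalars_scaleE -linearZ module_of_scaleE gact_scalar.
have f_lin : linear (f : scalars_of X -> scalars_of Y).
  by move=> c x y; rewrite linearD /= scalars_scaleE linearZ.
apply: (tens_lin_ext (lin_comp f_lin h_lin) g_lin) => x n /=.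
rewrite h_tens tens_as_diag (lift_comp _ _ f_lin) (lift_comp _ _ g_lin).
apply: eq_lift => h1 h2.
by rewrite h_unit linearZ /= lE -linearZ.
Qed.

End Cover.

End CanonicalCover.

Section Syzygy.
Variables (G : zmodType) (k : fieldType) (chi : bicharacter G k).
Variables (H : colourHopfAlgebra chi) (A : comoduleColourAlgebra H).
Variable theta : {lrmorphism H -> A}.
Hypothesis theta_colinear : colinear_from_hopf theta.
Local Notation RH := (regular_gmodule H).

Section Defn.
Variable N : gmodule A.
Local Notation T := (cover N).

Definition syzygy_space := kernel (mk_linear (@cover_map_klin _ _ _ H A N)).

Lemma syzygyE (x : syzygy_space) : cover_map (kval x) = 0.
Proof. exact: (kernelE x). Qed.

Definition syzygy_in (z : T) (z0 : cover_map z = 0) : syzygy_space :=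
  @to_kernel _ _ _ (mk_linear (@cover_map_klin _ _ _ H A N)) z z0.

Definition syzygy_deg (g : G) (x : syzygy_space) : Prop :=
  gdeg (g0 := T) g (kval x).

Lemma syzygy_val_lin : linear (fun x : syzygy_space => (kval x : T)).
Proof. exact: kval_lin. Qed.

Lemma syzygy_graded : is_graded_space syzygy_deg.
Proof.
apply: kernel_graded (gdegP T) _ => g z z0.
have cD := fun_linD (@cover_map_klin _ _ _ H A N).
rewrite -[LHS]/(cover_map _) (graded_hcomp _ _ (gdegP T).1 (gdegP N).1 cD).
  by rewrite [cover_map z]z0; apply: hcomp0; apply: (gdegP N).1.
exact: cover_map_deg.
Qed.

Lemma syzygy_act_subproof (a : A) (x : syzygy_space) :
  cover_map (gact (g0 := T) a (kval x)) = 0.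
Proof.
rewrite (cover_map_act theta_colinear) syzygyE.
exact: (fun_lin0 ((gact_bil N).2 a)).
Qed.

Definition syzygy_act (a : A) (x : syzygy_space) : syzygy_space :=
  syzygy_in (syzygy_act_subproof a x).

Lemma syzygy_act_bil : is_bilinear syzygy_act.
Proof.
have [gl gr] := gact_bil T.
split=> [x|a] c u v; apply: kval_inj; rewrite [RHS]syzygy_val_lin.
  exact: gl.
rewrite -[LHS]/(gact (g0 := T) a (kval (c *: u + v))) [X in gact a X]syzygy_val_lin.
exact: gr.
Qed.

Definition syzygy : gmodule A.
Proof.
apply: (@GModule G k A syzygy_space syzygy_deg syzygy_graded syzygy_act
  syzygy_act_bil).
- by move=> a b x; apply: kval_inj; apply: (gactA (g0 := T)).
- by move=> x; apply: kval_inj; apply: (gact1 (g0 := T)).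
- by move=> g g' a x; apply: (gact_deg (g0 := T)).
Defined.

Definition syzygy_val (x : syzygy) : T := kval x.

Lemma syzygy_valA : 
  @GRing.linear_for A (module_of syzygy) (module_of T) *:%R syzygy_val.
Proof. by move=> a x y; rewrite /syzygy_val (fun_linD syzygy_val_lin). Qed.

Lemma cover_mapA :
  @GRing.linear_for A (module_of T) (module_of N) *:%R (@cover_map _ _ _ H A N).
Proof.
move=> a x y; rewrite (fun_linD (@cover_map_klin _ _ _ H A N)).
by congr (_ + _); apply: (cover_map_act theta_colinear).
Qed.

Lemma syzygy_exact : @short_exact G k A (module_of syzygy) (module_of T)
  (module_of N) syzygy_val (@cover_map _ _ _ H A N).
Proof.
split; first exact: kval_inj.
- by move=> z; split=> [z0|[x <-]]; [exists (syzygy_in z0) | apply: syzygyE].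
- by move=> n; exists (tens (1 : RH) n); apply: cover_map_unit.
Qed.

End Defn.

Fixpoint syzygies (n : nat) (N : gmodule A) : gmodule A :=
  if n is n'.+1 then syzygies n' (syzygy N) else N.

Hypothesis A_div : coinvariants_division_ring A.

Lemma projective_of_graded (P : gradedModule A) :
  graded_projective P -> projective P.
Proof.
move=> projP; pose X := gmodule_of P.
have cA : @GRing.linear_for A (module_of (cover X)) P *:%R (@cover_map _ _ _ H A X).
  exact: cover_mapA.
pose c : {linear module_of (cover X) -> P} := mk_linear cA.
have [|||s [_ sK]] := projP (graded_of (cover X)) P c idfun.
- exact: (@cover_map_deg _ _ _ H A X).
- by move=> g m.
- by case: (syzygy_exact X).
apply: (projective_retract (s := s) (r := c) _ sK).
by apply: (cover_projective theta_colinear).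
Qed.

Lemma projective_syzygies n (Y : lmodType A) (X : gmodule A) :
  projective_resolution n Y -> stable_le (module_of X) Y ->
  projective (module_of (syzygies n X)).
Proof.
elim: n X Y => [|n IHn] X Y resY leXY.
  exact: projective_stable_le (projective_resolution0 resY) leXY.
have [K [P [i [f [projP ex resK]]]]] := projective_resolutionS resY.
apply: (IHn (syzygy X) K resK).
apply: (stable_le_syzygy (i := i) (f := f) (j := mk_linear (@syzygy_valA X))
  (e := mk_linear (@cover_mapA X)) ex projP _ _ leXY).
- exact: syzygy_exact.
- by apply: (cover_projective theta_colinear).
Qed.

Lemma zero_gmodule_graded :
  @is_graded_space G k 'M[k]_(0, 0) (fun _ _ => True).
Proof.
split=> //; split=> // [u|s f _ _ _ g _]; last exact: flatmx0.
by exists [::], (fun=> 0); split=> //; rewrite big_nil [u]flatmx0.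
Qed.

Lemma zero_gmodule_bil :
  is_bilinear (fun (_ : A) (u : 'M[k]_(0, 0)) => u : 'M[k]_(0, 0)).
Proof. by split=> ? ? ? ?; rewrite [LHS]flatmx0 [RHS]flatmx0. Qed.

Definition zero_gmodule : gmodule A :=
  @GModule G k A 'M[k]_(0, 0) (fun _ _ => True) zero_gmodule_graded
    (fun _ u => u) zero_gmodule_bil (fun _ _ _ => erefl) (fun _ => erefl)
    (fun _ _ _ _ _ _ => I).

Lemma zero_gmodule_eq0 (x : zero_gmodule) : x = 0.
Proof. exact: (flatmx0 (x : 'M[k]_(0, 0))). Qed.

Lemma graded_resolution0 (P M : gradedModule A) (e : {linear P -> M}) :
  graded_map (@mdeg _ _ _ P) (@mdeg _ _ _ M) e -> injective e -> surj e ->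
  graded_projective P -> graded_projective_resolution 0 M.
Proof.
move=> eD e_inj e_surj projP; pose Z := graded_of zero_gmodule.
pose Q i := if i is _.+1 then Z else P.
pose d i : {linear Q i.+1 -> Q i} := mk_linear (f := fun=> 0)
  (fun _ _ _ => esym (etrans (addr0 _) (scaler0 _ _))).
exists Q, d, e; split=> //.
- case=> // i X Y f g fD gD _; exists (mk_linear (f := fun=> 0)
    (fun _ _ _ => esym (etrans (addr0 _) (scaler0 _ _)))); split.
    by move=> g' x _; apply: (deg0 (mdeg_grading X)).
  by move=> x /=; rewrite (zero_gmodule_eq0 x) !linear0.
- by move=> i g x _; apply: (deg0 (mdeg_grading (Q i))).
split=> //.
- move=> x; split=> [ex0|[y <-]]; last exact: linear0.
  by exists 0; apply: e_inj; rewrite ex0; apply: (linear0 e).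
- move=> i x; split=> _; last by [].
  by exists 0; rewrite linear0; exact (esym (zero_gmodule_eq0 x)).
- by case=> // i _ x; exact (zero_gmodule_eq0 x).
Qed.

Lemma graded_resolutionS n (X : gmodule A) (M : gradedModule A)
    (e : {linear module_of X -> M}) :
  graded_map (@gdeg _ _ _ X) (@mdeg _ _ _ M) e -> injective e -> surj e ->
  graded_projective_resolution n (graded_of (syzygy X)) ->
  graded_projective_resolution n.+1 M.
Proof.
move=> eD e_inj e_surj [P [d [eps [projP dD epsD [eps_surj kereps kerd P0]]]]].
have [val_inj' kerc c_surj] := syzygy_exact X.
pose Q i := if i is j.+1 then P j else graded_of (cover X).
pose val' : {linear graded_of (syzygy X) -> graded_of (cover X)} :=
  mk_linear (@syzygy_valA X).
pose d' i : {linear Q i.+1 -> Q i} :=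
  match i return {linear Q i.+1 -> Q i} with
  | 0 => val' \o eps | j.+1 => d j end.
pose c : {linear graded_of (cover X) -> module_of X} := mk_linear (@cover_mapA X).
exists Q, d', (e \o c); split.
- case=> [|i]; last exact: projP.
  by apply: graded_projective_of; apply: (cover_projective theta_colinear).
- by case=> [|i]; [move=> g x Dx; apply: epsD | apply: dD].
- by move=> g x Dx; apply: eD; apply: (@cover_map_deg _ _ _ H A X).
split.
- move=> m; have [y <-] := e_surj m; have [z <-] := c_surj y; by exists z.
- move=> x /=; split=> [/= ecx0|[y <-]].
    have /kerc[y yE] : cover_map x = 0 by apply: e_inj; rewrite linear0.
    by have [z zE] := eps_surj y; exists z; rewrite -yE -zE.
  rewrite /= (_ : cover_map _ = 0) ?linear0 //; apply/kerc.
  by exists (eps y).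
- case=> [|i] x; last exact: kerd.
  rewrite -kereps; split=> [v0|E].
    by apply: val_inj'; rewrite [RHS](linear0 val').
  by rewrite -[LHS]/(val' (eps x)) E; apply: (linear0 val').
- by case=> // i; apply: P0.
Qed.

Lemma graded_resolution_of_syzygies n (X : gmodule A) (M : gradedModule A)
    (e : {linear module_of X -> M}) :
  graded_map (@gdeg _ _ _ X) (@mdeg _ _ _ M) e -> injective e -> surj e ->
  projective (module_of (syzygies n X)) -> graded_projective_resolution n M.
Proof.
elim: n X M e => [|n IHn] X M e eD e_inj e_surj projX.
  apply: (graded_resolution0 (P := graded_of X) eD) => //.
  exact: graded_projective_of.
apply: (graded_resolutionS eD) => //.
apply: (IHn (syzygy X) (graded_of (syzygy X)) idfun) => //.
by move=> x; exists x.
Qed.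

End Syzygy.

(** * Tensoring a graded module with a fixed one *)

Section TensorFunctor.
Variables (G : zmodType) (k : fieldType) (chi : bicharacter G k).
Variables (H : colourHopfAlgebra chi) (A : comoduleColourAlgebra H).

Lemma tens_map_pair_act (P Q : gmodule H) (M : gmodule A) (f : P -> Q) h a x :
  linear f -> (forall h p, f (gact h p) = gact h (f p)) ->
  graded_map (@gdeg _ _ _ P) (@gdeg _ _ _ Q) f ->
  tens_map f (id : M -> M) (pair_act h a x) =
  pair_act h a (tens_map f (id : M -> M) x).
Proof.
move=> lf fact fdeg; have lid : linear (id : M -> M) by [].
have lt := tens_map_lin lf lid.
apply: (tens_homog_lin_ext (gdegP P) (gdegP M) (lin_comp lt (pair_act_lin h a))
  (lin_comp (pair_act_lin h a) lt)) => g g' p m Dp _.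
apply: (homog_lin_ext (f := fun a => tens_map f id (pair_act h a (tens p m)))
  (h := fun a => pair_act h a (tens_map f id (tens p m)))
  (cdeg_graded A).1) => [||d {}a Da].
- by apply: (lin_comp lt); apply: (pair_act_bil (tens p m)).2.
- exact: (pair_act_bil _).2.
rewrite (pair_actE _ _ Da Dp) (fun_linZ lt) !tens_mapE // fact.
by rewrite (pair_actE _ _ Da (fdeg _ _ Dp)).
Qed.

Lemma tens_map_diag_act (P Q : gmodule H) (M : gmodule A) (f : P -> Q) a x :
  linear f -> (forall h p, f (gact h p) = gact h (f p)) ->
  graded_map (@gdeg _ _ _ P) (@gdeg _ _ _ Q) f ->
  tens_map f (id : M -> M) (diag_act a x) =
  diag_act a (tens_map f (id : M -> M) x).
Proof.
move=> lf fact fdeg; have lid : linear (id : M -> M) by [].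
rewrite (lift_comp _ _ (tens_map_lin lf lid)); apply: eq_lift => h a'.
exact: tens_map_pair_act.
Qed.

Variable theta : {lrmorphism H -> A}.
Hypothesis theta_colinear : colinear_from_hopf theta.
Hypothesis theta_graded : graded_map (@cdeg _ _ H) (@cdeg _ _ A) theta.
Local Notation RH := (regular_gmodule H).
Local Notation res := (restrict_gmodule theta_graded).

Definition tensor_module (P M : gmodule A) : gmodule A := diag_gmodule (res P) M.

Lemma tens_mapA (P Q M : gmodule A) (f : {linear module_of P -> module_of Q}) :
  graded_map (@gdeg _ _ _ P) (@gdeg _ _ _ Q) f ->
  linear (f : P -> Q) /\
  @GRing.linear_for A (module_of (tensor_module P M))
    (module_of (tensor_module Q M)) *:%R (tens_map (f : P -> Q) (id : M -> M)).
Proof.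
move=> fD; have lf : linear (f : P -> Q).
  move=> c x y; rewrite linearD -(gact_scalar c x) -(gact_scalar c (f x)).
  by congr (_ + _); rewrite -module_of_scaleE linearZ.
split=> // a x y; have lt := tens_map_lin lf (@lin_id _ M).
rewrite (fun_linD lt); congr (_ + _).
apply: (@tens_map_diag_act (res P) (res Q)) => // h p.
by rewrite /= -!module_of_scaleE linearZ.
Qed.

Section Associativity.
Variables X M : gmodule A.
Local Notation CX := (cover X).
Local Notation T1 := (tensor_module CX M).
Local Notation T2 := (cover (tensor_module X M)).

Definition cover_assoc : T1 -> T2 := @tens_assoc k RH X M.

Lemma cover_assoc_lin : linear cover_assoc.
Proof. exact: tens_assoc_lin. Qed.

Section Homogeneous.
Variables (g d : G) (h : H) (x : X) (m : M).
Hypotheses (Dh : cdeg g h) (Dx : gdeg d x).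

(* The action of u (x) v (x) w on h (x) x (x) m, for |h| = g and |x| = d. *)
Definition triple_act (u v : H) (w : A) : T2 :=
  hext (@cdeg _ _ H) (fun e v' => hext (@cdeg _ _ A) (fun e' w' =>
    (chi e g * chi e' (g + d)) *:
      tens (u * h : RH) (tens (gact (theta v') x) (gact w' m))) w) v.

Lemma triple_act_tri : is_trilinear triple_act.
Proof.
have [gl _] := gact_bil X; have [ml _] := gact_bil M.
have [hl _] := mul_bilinear H.
split=> [v w|u w|u v].
- apply: lin_sum => e; apply: lin_sum => e'; apply: lin_scale.
  exact: (lin_comp (tens_linl _) (hl h)).
- apply: (hext_lin (cdeg_graded H)) => e; apply: lin_sum => e'.
  apply: lin_scale; apply: (lin_comp (tens_linr _)).
  apply: (lin_comp (tens_linl _)); exact: (lin_comp (gl x) (theta_lin theta)).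
- apply: lin_sum => e; apply: (hext_lin (cdeg_graded A)) => e'.
  apply: lin_scale; apply: (lin_comp (tens_linr _)).
  exact: (lin_comp (tens_linr _) (ml m)).
Qed.

Lemma triple_actE u v w e e' : cdeg e v -> cdeg e' w ->
  triple_act u v w = (chi e g * chi e' (g + d)) *:
    tens (u * h : RH) (tens (gact (theta v) x) (gact w m)).
Proof.
move=> Dv Dw; have [gl _] := gact_bil X; have [ml _] := gact_bil M.
rewrite /triple_act (hext_deg (cdeg_graded H).1 _ Dv) => [|e1]; last first.
  apply: fun_linD; apply: lin_sum => e2.
  apply: lin_scale; apply: (lin_comp (tens_linr _)).
  apply: (lin_comp (tens_linl _)); exact: (lin_comp (gl x) (theta_lin theta)).
rewrite (hext_deg (cdeg_graded A).1 _ Dw) => [//|e1].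
apply: fun_linD; apply: lin_scale; apply: (lin_comp (tens_linr _)).
exact: (lin_comp (tens_linr _) (ml m)).
Qed.

Lemma assoc_pair_act u w :
  cover_assoc (pair_act (P := res CX) u w
    (tens (tens (h : RH) x : CX) m)) =
  tens_lift (fun u1 u2 => triple_act u1 u2 w) (comult H u).
Proof.
have [t1 t2 t3] := triple_act_tri; have [ml _] := gact_bil M.
set z : CX := tens (h : RH) x.
have Dz : gdeg (g0 := CX) (g + d) z by apply: tens_deg_tens.
apply: (homog_lin_ext
  (f := fun w => cover_assoc (pair_act (P := res CX) u w (tens z m)))
  (h := fun w => tens_lift (fun u1 u2 => triple_act u1 u2 w) (comult H u))
  (cdeg_graded A).1) => [||e' {}w Dw].
- by apply: (lin_comp cover_assoc_lin); apply: (pair_act_bil (tens _ m)).2.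
- by apply: lift_param => u1 u2; apply: t3.
rewrite (@pair_actE _ _ _ _ _ (res CX) M u w z m _ _ Dw Dz) /=.
rewrite /z /diag_act (lift_coact_theta theta_colinear); last exact: pair_act_bil.
rewrite (fun_linZ cover_assoc_lin).
have lta := lin_comp cover_assoc_lin (@tens_linl k CX M (gact w m)).
rewrite (lift_comp _ _ lta).
rewrite (lift_comp _ _ (lin_scale (chi e' (g + d)) (@lin_id _ _))).
apply: eq_lift => u1 u2.
apply: (homog_lin_ext (f := fun u2 => chi e' (g + d) *: cover_assoc
    (tens (pair_act (P := RH) u1 (theta u2) (tens (h : RH) x) : CX) (gact w m)))
  (h := fun u2 => triple_act u1 u2 w) (cdeg_graded H).1) => [|//|e {}u2 Du].
- apply: lin_scale; apply: (lin_comp lta).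
  apply: (lin_comp ((pair_act_bil _).2 u1)); exact: theta_lin.
rewrite (@pair_actE _ _ _ _ _ RH X u1 _ h x _ _ (theta_graded Du) Dh).
rewrite (fun_linZ (@tens_linl k CX M (gact w m))) (fun_linZ cover_assoc_lin).
by rewrite /cover_assoc tens_assocE scalerA (triple_actE _ Du Dw) mulrC.
Qed.

Lemma coact_triple_act u (w : A) :
  tens_lift (triple_act u) (coact A w) =
  pair_act (P := RH) (M := tensor_module X M) u w
    (tens (h : RH) (tens x m : tensor_module X M)).
Proof.
have [t1 t2 t3] := triple_act_tri.
have t_bil : is_bilinear (triple_act u) by split=> y; [apply: t2 | apply: t3].
apply: (homog_lin_ext (f := fun w => tens_lift (triple_act u) (coact A w))
  (h := fun w => pair_act (P := RH) (M := tensor_module X M) u w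
    (tens (h : RH) (tens x m : tensor_module X M)))
  (cdeg_graded A).1) => [||e {}w Dw].
- by apply: (lin_comp (lift_lin t_bil)); apply: linearP.
- exact: (pair_act_bil _).2.
rewrite (@pair_actE _ _ _ _ _ RH (tensor_module X M) u w h _ _ _ Dw Dh) /=.
have [_ coactD _ _] := coactP A; have [s [sP sE] sg] := coactD e w Dw.
rewrite sE (lift_sum t_bil) (diag_act_sum (P := res X) (tens x m) sE).
have lt := @tens_linr k RH (tensor_module X M) (u * h).
rewrite (fun_lin_sum lt) scaler_sumr big_seq [RHS]big_seq.
apply: eq_bigr => q qs; have [Dv Dw'] := sP q qs.
rewrite (triple_actE _ Dv Dw').
rewrite (@pair_actE _ _ _ _ _ (res X) M q.2.1 q.2.2 x m _ _ Dw' Dx).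
rewrite (fun_linZ lt) scalerA -(sg q qs); congr (_ *: _).
by rewrite bichDl bichDr mulrA.
Qed.

End Homogeneous.

Lemma cover_assoc_act (a : A) z :
  cover_assoc (gact (g0 := T1) a z) = gact (g0 := T2) a (cover_assoc z).
Proof.
have lc := cover_assoc_lin.
have [_ d1] := gact_bil T1; have [_ d2] := gact_bil T2.
apply: (tens_lin_ext (f := fun z => cover_assoc (gact (g0 := T1) a z))
  (h := fun z => gact (g0 := T2) a (cover_assoc z))) => [||y m].
- exact: (lin_comp lc (d1 a)).
- exact: (lin_comp (d2 a) lc).
have lt := @tens_linl k CX M m.
apply: (tens_homog_lin_ext (DM := @cdeg _ _ H) (DN := @gdeg _ _ _ X)
  (f := fun y => cover_assoc (gact (g0 := T1) a (tens (y : CX) m)))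
  (h := fun y => gact (g0 := T2) a (cover_assoc (tens (y : CX) m)))
  (cdeg_graded H) (gdegP X)) => [||g d h x Dh Dx].
- by apply: (lin_comp lc); apply: (lin_comp (d1 a)).
- by apply: (lin_comp (d2 a)); apply: (lin_comp lc).
rewrite [in RHS]/cover_assoc tens_assocE /= /diag_act (lift_comp _ _ lc).
rewrite (eq_lift (h := fun u w =>
  tens_lift (fun u1 u2 => triple_act g d h x m u1 u2 w) (comult H u))).
  rewrite (coact_coassoc _ (triple_act_tri g d h x m)).
  by apply: eq_lift => u w; rewrite (coact_triple_act m Dh Dx).
by move=> u w; apply: assoc_pair_act.
Qed.

Lemma cover_map_assoc z : cover_map (cover_assoc z) =
  tens_map (@cover_map _ _ _ H A X : CX -> X) (id : M -> M) z.
Proof.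
have lid : linear (id : M -> M) by [].
have lX := @cover_map_klin _ _ _ H A X.
have lT := @cover_map_klin _ _ _ H A (tensor_module X M).
have lt := tens_map_lin lX lid.
apply: (tens_lin_ext (lin_comp lT cover_assoc_lin) lt) => y m.
have ltm := @tens_linl k CX M m.
apply: (tens_lin_ext (f := fun y => cover_map (cover_assoc (tens (y : CX) m)))
  (h := fun y => tens_map (@cover_map _ _ _ H A X : CX -> X) (id : M -> M)
    (tens (y : CX) m))).
- by apply: (lin_comp lT); apply: (lin_comp cover_assoc_lin).
- exact: (lin_comp lt ltm).
move=> h x; rewrite tens_mapE // /cover_assoc tens_assocE /cover_map.
rewrite !lift_tens; [|exact: cover_map_bil|exact: cover_map_bil].
by rewrite (fun_linZ (@tens_linl k X M m)).
Qed.

End Associativity.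

Hypothesis A_div : coinvariants_division_ring A.

(* A graded section of the cover of P, tensored with M, lands in the cover of
   P (x) M by associativity, and is a section of the latter cover. *)
Lemma tensor_projective (P M : gmodule A) :
  projective (module_of P) -> projective (module_of (tensor_module P M)).
Proof.
move=> projP.
pose c : {linear graded_of (cover P) -> module_of P} :=
  mk_linear (cover_mapA theta_colinear (N := P)).
have [|||s [sD sK]] := @graded_projective_of _ _ _ (graded_of P) projP
  (graded_of (cover P)) (graded_of P) c idfun.
- exact: cover_map_deg.
- by [].
- by case: (syzygy_exact theta_colinear P).
have [ls lsA] := tens_mapA M sD.
have lsa : @GRing.linear_for A (module_of (tensor_module P M))
    (module_of (cover (tensor_module P M))) *:%R
    (fun z => cover_assoc (tens_map (s : P -> cover P) (id : M -> M) z)).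
  move=> a x y; rewrite lsA (fun_linD (@cover_assoc_lin P M)); congr (_ + _).
  exact: cover_assoc_act.
apply: (projective_retract (s := mk_linear lsa)
  (r := mk_linear (cover_mapA theta_colinear (N := tensor_module P M)))).
  by apply: (cover_projective theta_colinear).
move=> z /=; rewrite cover_map_assoc.
have lid : linear (id : M -> M) by [].
have lc := @cover_map_klin _ _ _ H A P.
apply: (tens_lin_ext (f := fun z => tens_map _ _ (tens_map _ _ z))
  (h := id)) => // [|p m].
  exact: (lin_comp (tens_map_lin lc lid) (tens_map_lin ls lid)).
by rewrite !tens_mapE //; congr (tens _ _); apply: sK.
Qed.

Lemma tensor_syzygy_exact (X M : gmodule A) :
  @short_exact G k A (module_of (tensor_module (syzygy theta_colinear X) M))
    (module_of (tensor_module (cover X) M)) (module_of (tensor_module X M))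
    (tens_map (@syzygy_val _ _ _ H A _ theta_colinear X) (id : M -> M))
    (tens_map (@cover_map _ _ _ H A X : cover X -> X) (id : M -> M)).
Proof.
set v := @syzygy_val _ _ _ H A _ theta_colinear X.
set c : cover X -> X := @cover_map _ _ _ H A X.
have lid : linear (id : M -> M) by [].
have lv : linear v := @syzygy_val_lin _ _ _ H A X.
have lc : linear c := @cover_map_klin _ _ _ H A X.
pose u (x : X) : cover X := tens (1 : RH) x.
have lu : linear u by apply: tens_linr.
have cu x : c (u x) = x by apply: cover_map_unit.
have q0 z : cover_map (z - u (c z)) = 0.
  by rewrite -[LHS]/(c _) (fun_linB lc) cu subrr.
pose q (z : cover X) : syzygy theta_colinear X := syzygy_in (q0 z).
have lq : linear q.
  move=> a y z; apply: kval_inj; rewrite [RHS]lv /= lc lu.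
  by rewrite scalerBr opprD addrACA.
have cv x : c (v x) = 0 by apply: syzygyE.
have qv x : q (v x) = x.
  by apply: kval_inj; rewrite /= cv (fun_lin0 lu) subr0.
have tK (V W : lmodType k) (f : V -> W) (h : W -> V) : linear f -> linear h ->
    cancel f h -> cancel (tens_map f (id : M -> M)) (tens_map h (id : M -> M)).
  move=> lf lh fK; apply: (tens_lin_ext (h := id)) => // [|x m].
    exact: (lin_comp (tens_map_lin lh lid) (tens_map_lin lf lid)).
  by rewrite !tens_mapE // fK.
split.
- exact: can_inj (tK _ _ _ _ lv lq qv).
- move=> z; split=> [z0|[y <-]].
    exists (tens_map q id z); apply/esym.
    rewrite -[LHS]subr0 -(fun_lin0 (tens_map_lin lu lid)) -z0.
    apply: (tens_lin_ext (f := fun z => z - tens_map u id (tens_map c id z))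
      (h := fun z => tens_map v id (tens_map q id z))) => [||y m].
    + move=> a x y; rewrite (tens_map_lin lc lid) (tens_map_lin lu lid).
      by rewrite scalerBr opprD addrACA.
    + exact: (lin_comp (tens_map_lin lv lid) (tens_map_lin lq lid)).
    rewrite !tens_mapE // -(fun_linB (@tens_linl k (cover X) M m)).
    by [].
  apply: (tens_lin_ext (f := fun y => tens_map c id (tens_map v id y))
    (h := fun=> 0)) => [||x m].
  + exact: (lin_comp (tens_map_lin lc lid) (tens_map_lin lv lid)).
  + by move=> a x' y'; rewrite scaler0 addr0.
  by rewrite !tens_mapE // cv (fun_lin0 (tens_linl _)).
- by move=> z; exists (tens_map u id z); apply: (tK _ _ _ _ lu lc cu).
Qed.

Lemma stable_le_syzygies n (N X M : gmodule A) :
  stable_le (module_of N) (module_of (tensor_module X M)) ->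
  stable_le (module_of (syzygies theta_colinear n N))
    (module_of (tensor_module (syzygies theta_colinear n X) M)).
Proof.
elim: n N X => [//|n IHn] N X leNX; apply: IHn.
have vA := @syzygy_valA _ _ _ H A _ theta_colinear X.
have cA := cover_mapA theta_colinear (N := X).
have [_ tvA] : _ /\ _ := @tens_mapA (syzygy theta_colinear X) (cover X) M
  (mk_linear vA) (fun g x Dx => Dx).
have [_ tcA] : _ /\ _ := @tens_mapA (cover X) X M (mk_linear cA)
  (@cover_map_deg _ _ _ H A X).
apply: (stable_le_syzygy (i := mk_linear tvA) (f := mk_linear tcA)
  (j := mk_linear (@syzygy_valA _ _ _ H A _ theta_colinear N))
  (e := mk_linear (cover_mapA theta_colinear (N := N))) _ _ _ _ leNX).
- exact: tensor_syzygy_exact.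
- by apply: tensor_projective; apply: (cover_projective theta_colinear).
- exact: syzygy_exact.
- by apply: (cover_projective theta_colinear).
Qed.

End TensorFunctor.

Lemma enat_least_ext (P Q : nat -> Prop) :
  (forall n, P n <-> Q n) -> enat_least P = enat_least Q.
Proof. by move=> PQ; congr enat_least; apply/funext => n; apply/propext. Qed.

Lemma enat_least_le (P : nat -> Prop) n : P n -> enat_le (enat_least P) n.
Proof.
move=> Pn; rewrite /enat_least; case: pselect => [exP|[]]; last first.
  by exists n; apply/asboolP.
by case: ex_minnP => m _; apply; apply/asboolP.
Qed.

Lemma enat_leP (P : nat -> Prop) n : enat_le (enat_least P) n ->
  exists2 m, (m <= n)%N & P m.
Proof.
rewrite /enat_least; case: pselect => // exP.
by case: ex_minnP => m /asboolP Pm _ mn; exists m.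
Qed.

Lemma enat_least_upper (P Q : nat -> Prop) : (forall n, P n -> Q n) ->
  (forall n, Q n -> exists2 m, (m <= n)%N & P m) -> enat_least P = enat_least Q.
Proof.
move=> PQ QP; rewrite /enat_least; case: pselect => [exP|nexP]; last first.
  case: pselect => // exQ; case: nexP; have [n /asboolP Qn] := exQ.
  have [m _ Pm] := QP n Qn.
  by exists m; apply/asboolP.
case: pselect => [exQ|[]]; last first.
  by case: exP => n /asboolP /PQ Qn; exists n; apply/asboolP.
congr Some; case: ex_minnP => m /asboolP Pm mmin.
case: ex_minnP => n /asboolP Qn nmin; apply/eqP; rewrite eqn_leq.
have [m' m'n Pm'] := QP n Qn; rewrite nmin ?andbT; last exact/asboolP/PQ.
by apply: leq_trans m'n; apply/mmin/asboolP.
Qed.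

Section ColourSimple.
Variables (G : zmodType) (k : fieldType) (chi : bicharacter G k).
Variables (H : colourHopfAlgebra chi) (A : comoduleColourAlgebra H).
Hypothesis A_comm : colour_commutative chi A.
Local Notation RH := (regular_gmodule H).
Local Notation RA := (regular_gmodule A).
Local Notation D := (@cdeg _ _ A).

Lemma coinv_ideal_costable g (b : A) : coinvariant b -> D g b ->
  is_graded_costable_ideal (fun x : A => exists a, x = a * b).
Proof.
move=> cb Db; have [Ag AZ] := cdeg_graded A.
split.
- by exists 0; rewrite mul0r.
- by move=> _ _ [a ->] [a' ->]; exists (a - a'); rewrite mulrBl.
- by move=> a _ [a' ->]; exists (a * a'); rewrite mulrA.
- move=> c _ [a ->].
  suff [c' E] : exists c', b * c = c' * b.
    by exists (a * c'); rewrite -mulrA E mulrA.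
  elim/(homog_ind Ag): c => [|c d [c' Ec] [d' Ed]|d c Dc].
  + by exists 0; rewrite mul0r mulr0.
  + by exists (c' + d'); rewrite mulrDr mulrDl Ec Ed.
  + by exists (chi g d *: c); rewrite (A_comm Db Dc) scalerAl.
- move=> _ [a ->].
  exists [seq d + g | d <- supp D a], (fun d => hcomp D (d - g) a * b); split.
  + by move=> d; rewrite -{1}[d](subrK g); apply: cdegM => //; apply: hcomp_deg.
  + by move=> d; exists (hcomp D (d - g) a).
  + rewrite big_map {1}(hcomp_sum Ag a) mulr_suml.
    by apply: eq_bigr => d _; rewrite addrK.
- move=> _ [a ->].
  exists [seq (q.1, q.2 * b) | q <- repr (coact A a)].
    by move=> _ /mapP[q _ ->]; exists q.2.
  by rewrite big_map coact_diag diag_actA -coact_diag cb (diag_act_unit (N := RA)).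
Qed.

Lemma division_ring_of_simple : colour_simple A -> coinvariants_division_ring A.
Proof.
move=> simple g b cb Db b0; have [Ag AZ] := cdeg_graded A.
have [/(_ b)|all1] := simple _ (coinv_ideal_costable cb Db).
  by move=> bE; case/eqP: b0; apply: bE; exists 1; rewrite mul1r.
have [a aE] := all1 1.
pose b' := hcomp D (- g) a.
have Db' : D (- g) b' by apply: hcomp_deg.
have b'b : b' * b = 1.
  rewrite -[LHS](@hcomp_gact _ _ _ _ A RA (- g) g a b Db) /= -aE addNr.
  by apply: (hcomp_id Ag); apply: cdeg1.
have bb' : b * b' = 1.
  have bb'E : b * b' = (chi g (- g))%:A by rewrite (A_comm Db Db') b'b.
  have : b = chi g (- g) *: b.
    by rewrite -[LHS]mulr1 -b'b mulrA bb'E -scalerAl mul1r.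
  move/eqP; rewrite -subr_eq0 -{1}[b]scale1r -scalerBl scaler_eq0 (negPf b0) orbF.
  by rewrite subr_eq0 bb'E => /eqP <-; rewrite scale1r.
exists b'; split=> //.
have dA := @diag_actA _ _ _ _ A RH RA.
have K (z : tensor RH RA) : z = diag_act b' (diag_act b z).
  by rewrite -dA b'b (@diag_act1 _ _ _ _ A RH RA).
rewrite /coinvariant [LHS](K (coact A b')) [RHS](K (tens (1 : RH) (b' : RA))).
rewrite [diag_act b (tens _ _)](diag_act_coinv (N := RA)) // /= bb'.
rewrite [coact A b']coact_diag -[diag_act b _]dA bb'.
by rewrite (@diag_act1 _ _ _ _ A RH RA).
Qed.

End ColourSimple.

(** * The module of coinvariants *)

Section CoinvariantsModule.
Variables (G : zmodType) (k : fieldType) (chi : bicharacter G k).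
Variables (H : colourHopfAlgebra chi) (A : comoduleColourAlgebra H).
Hypothesis A_comm : colour_commutative chi A.
Variable theta : {lrmorphism H -> A}.
Hypothesis theta_graded : graded_map (@cdeg _ _ H) (@cdeg _ _ A) theta.
Hypothesis theta_colinear : colinear_from_hopf theta.
Local Notation p := (coinv_proj theta).
Local Notation D := (@cdeg _ _ A).

Section Existence.

Lemma coact_sub_unit_lin : linear (fun a : A => coact A a - tens (1 : H) a).
Proof.
move=> c a b; rewrite linearP (tens_linr (1 : H) c a b).
by rewrite scalerBr opprD addrACA.
Qed.

Definition coinv_space := kernel (mk_linear coact_sub_unit_lin).

Lemma coinv_spaceP (x : coinv_space) : coinvariant (kval x : A).
Proof. by apply/eqP; rewrite -subr_eq0; apply/eqP; apply: (kernelE x). Qed.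

Lemma coinv_space_subproof (a : A) :
  coinvariant a -> mk_linear coact_sub_unit_lin a = 0.
Proof. by move=> /= ->; rewrite subrr. Qed.

Definition coinv_in (a : A) (ca : coinvariant a) : coinv_space :=
  to_kernel (coinv_space_subproof ca).

Definition coinv_act (a : A) (x : coinv_space) : coinv_space :=
  coinv_in (coinv_proj_coinv theta_colinear (a * kval x)).

Lemma coinv_space_graded :
  is_graded_space (fun g (x : coinv_space) => D g (kval x)).
Proof.
apply: kernel_graded (cdeg_graded A) _ => g b b0.
apply: coinv_space_subproof; apply: coinv_hcomp.
by apply/eqP; rewrite -subr_eq0; apply/eqP.
Qed.

Lemma coinv_act_bil : is_bilinear coinv_act.
Proof.
have [ml mr] := mul_bilinear A; have lp := coinv_proj_lin theta.
have lv := @kval_lin _ _ _ (mk_linear coact_sub_unit_lin).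
split=> [x|a] c u v; apply: kval_inj; rewrite [RHS]lv /=.
  by rewrite (ml (kval x) c u v) lp.
by rewrite [X in a * X](lv c u v) (mr a) lp.
Qed.

Definition coinv_gmodule : gmodule A.
Proof.
apply: (GModule coinv_space_graded coinv_act_bil).
- move=> a b x; apply: kval_inj.
  rewrite /= -mulrA !(coinv_projM theta_colinear A_comm theta_graded a).
  by congr (_ * _); rewrite [RHS]coinv_proj_id //; apply: coinv_proj_coinv.
- move=> x; apply: kval_inj; rewrite /= mul1r.
  by apply: coinv_proj_id; apply: coinv_spaceP.
- by move=> g g' a x Da Dx; apply: coinv_proj_deg => //; apply: cdegM.
Defined.

Definition coinv_incl (x : graded_of coinv_gmodule) : A := kval (x : coinv_space).

Lemma coinv_inclB (x y : graded_of coinv_gmodule) :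
  coinv_incl (x - y) = coinv_incl x - coinv_incl y.
Proof. exact: fun_linB (@kval_lin _ _ _ _) _ _. Qed.

Lemma coinvariants_module_exists :
  exists (B : gradedModule A) (iota : {additive B -> A}),
    is_coinvariants_module theta iota.
Proof.
pose iota : {additive graded_of coinv_gmodule -> A} :=
  HB.pack coinv_incl (GRing.isZmodMorphism.Build _ _ _ coinv_inclB).
exists (graded_of coinv_gmodule), iota; split=> //.
- exact: kval_inj.
- move=> x; split=> [cx|[b <-]]; first by exists (coinv_in cx).
  exact: coinv_spaceP.
Qed.

End Existence.

Section Dimensions.
Hypothesis A_div : coinvariants_division_ring A.
Variables (B : gradedModule A) (iota : {additive B -> A}).
Hypothesis iotaP : is_coinvariants_module theta iota.
Local Notation BG := (gmodule_of B).
Local Notation RB := (restrict_gmodule theta_graded BG).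

Lemma coinv_iota b : coinvariant (iota b).
Proof. by case: iotaP => _ + _ _ => /(_ (iota b)) ->; exists b. Qed.

Lemma iota_lin : linear (iota : BG -> A).
Proof.
have [_ _ _ iota_act] := iotaP; move=> c x y; rewrite raddfD; congr (_ + _).
rewrite scalars_scaleE iota_act -scalerAl mul1r (fun_linZ (coinv_proj_lin theta)).
by rewrite coinv_proj_id //; apply: coinv_iota.
Qed.

Lemma theta_act h (b : BG) : gact (g0 := RB) h b = hcounit h *: b.
Proof.
have [iota_inj _ _ iota_act] := iotaP; apply: iota_inj.
rewrite (fun_linZ iota_lin) /= iota_act coinv_proj_theta_mul //.
by rewrite coinv_proj_id //; apply: coinv_iota.
Qed.

Lemma pair_act_coinv (M : gmodule A) h a (b : BG) (m : M) g : mdeg g b ->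
  pair_act (P := RB) h a (tens b m) =
  hcounit h *: hext D (fun d a' => chi d g *: tens (b : RB) (gact a' m)) a.
Proof.
move=> Db; have [ml _] := gact_bil M.
have lF d : linear (fun a' => chi d g *: tens (b : RB) (gact a' m)).
  by apply: lin_scale; apply: (lin_comp (tens_linr _)).
apply: (homog_lin_ext (f := fun a => pair_act (P := RB) h a (tens b m))
  (h := fun a => hcounit h *:
    hext D (fun d a' => chi d g *: tens (b : RB) (gact a' m)) a)
  (cdeg_graded A).1) => [||d {}a Da].
- exact: (pair_act_bil _).2.
- by apply: lin_scale; apply: (hext_lin (cdeg_graded A)).
rewrite (@pair_actE _ _ _ _ _ RB M h a b m _ _ Da Db) theta_act.
rewrite (hext_deg (cdeg_graded A).1 _ Da) => [|e]; last exact: fun_linD (lF e).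
by rewrite (fun_linZ (tens_linl _)) !scalerA mulrC.
Qed.

Lemma diag_act_coinv_module (M : gmodule A) a (b : BG) (m : M) g : mdeg g b ->
  diag_act (P := RB) a (tens b m) =
  hext D (fun d a' => chi d g *: tens (b : RB) (gact a' m)) a.
Proof.
move=> Db; have [ml _] := gact_bil M.
rewrite -[RHS](coact_counit _ (hext_lin (cdeg_graded A) _)) => [|d]; last first.
  by apply: lin_scale; apply: (lin_comp (tens_linr _)).
by apply: eq_lift => h a'; apply: pair_act_coinv.
Qed.

(* M is a retract of B (x) M: the retraction b (x) m |-> b m is A-linear because
   A is colour-commutative. *)
Lemma stable_le_tensor_coinv (M : gmodule A) :
  stable_le (module_of M) (module_of (tensor_module theta_graded BG M)).
Proof.
have [iota_inj iota_im iota_deg iota_act] := iotaP.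
have [ml mr] := gact_bil M; have [Ag _] := cdeg_graded A.
have [b1 b1E] := (iota_im 1).1 (coinv1 A).
have Db1 : mdeg 0 b1 by rewrite iota_deg b1E; apply: cdeg1.
pose T := tensor_module theta_graded BG M.
pose s (m : M) : T := tens (b1 : RB) m.
have ls : linear s by apply: tens_linr.
have sA : @GRing.linear_for A (module_of M) (module_of T) *:%R s.
  move=> a x y; rewrite (fun_linD ls); congr (_ + _).
  rewrite /s !module_of_scaleE /= (diag_act_coinv_module _ _ Db1).
  have lF : linear (fun a => tens (b1 : RB) (gact a x)).
    exact: (lin_comp (tens_linr (b1 : RB)) (ml x)).
  apply: (homog_lin_ext (f := fun a => tens (b1 : RB) (gact a x)) Ag lF _)
    => [|d {}a Da].
    by apply: (hext_lin (cdeg_graded A)) => d; apply: lin_scale.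
  rewrite (hext_deg Ag _ Da) ?bich0r ?scale1r // => e.
  by apply: fun_linD; apply: lin_scale.
have r_bil : is_bilinear (fun (b : RB) (m : M) => gact (iota b) m).
  by split=> [m|b]; [apply: (lin_comp (ml m) iota_lin) | apply: mr].
pose r : T -> M := tens_lift (fun (b : RB) (m : M) => gact (iota b) m).
have lr : linear r := lift_lin r_bil.
have rA : @GRing.linear_for A (module_of T) (module_of M) *:%R r.
  move=> a x y; rewrite (fun_linD lr); congr (_ + _).
  rewrite !module_of_scaleE.
  rewrite -[RHS]/(gact a (r x)) -[LHS]/(r (gact (g0 := T) a x)).
  apply: (@tens_homog_lin_ext _ _ _ _ _ _ (gdegP RB) (gdegP M) _
    (fun x => r (gact (g0 := T) a x)) (fun x => gact a (r x))) => [||g g' b m Db _].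
  - exact: (lin_comp lr ((gact_bil T).2 a)).
  - exact: (lin_comp (mr a) lr).
  rewrite /= (diag_act_coinv_module _ _ Db) /r lift_tens // -gactA.
  have lF d : linear (fun a' => chi d g *: tens (b : RB) (gact a' m)).
    by apply: lin_scale; apply: (lin_comp (tens_linr _)).
  apply: (homog_lin_ext (f := fun a => r (hext D _ a))
    (h := fun a => gact (a * iota b) m) Ag) => [||d {}a Da].
  - exact: (lin_comp lr (hext_lin (cdeg_graded A) lF)).
  - exact: (lin_comp (ml m) ((mul_bilinear A).1 (iota b))).
  rewrite (hext_deg Ag _ Da) => [|e]; last exact: fun_linD (lF e).
  rewrite (fun_linZ lr) /r lift_tens // -gactA.
  by rewrite (A_comm Da ((iota_deg g b).1 Db)) (fun_linZ (ml m)).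
have l0 (U V : lmodType A) : linear (fun _ : U => 0 : V).
  by move=> a x y; rewrite scaler0 addr0.
exists (mk_linear sA), (mk_linear rA), (module_of (cover M)),
  (mk_linear (l0 _ _)), (mk_linear (l0 _ _)); split.
  by apply: (cover_projective theta_colinear).
by move=> m /=; rewrite addr0 /r /s lift_tens // b1E gact1.
Qed.

Lemma graded_resolution_of_coinv n : projective_resolution n B ->
  forall M : gradedModule A, graded_projective_resolution n M.
Proof.
move=> resB M; pose MG := gmodule_of M.
have idA : @GRing.linear_for A (module_of BG) B *:%R (fun b => b) by [].
have idA' : @GRing.linear_for A B (module_of BG) *:%R (fun b => b) by [].
have l0 (U V : lmodType A) : linear (fun _ : U => 0 : V).
  by move=> a x y; rewrite scaler0 addr0.
have leB : stable_le (module_of BG) B.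
  exists (mk_linear idA), (mk_linear idA'), (module_of (cover BG)),
    (mk_linear (l0 _ _)), (mk_linear (l0 _ _)); split.
    by apply: (cover_projective theta_colinear).
  by move=> b; apply: addr0.
have projB := projective_syzygies A_div (theta_colinear := theta_colinear) resB leB.
have projT := tensor_projective (M := MG) (theta_graded := theta_graded)
  theta_colinear A_div projB.
have leM := stable_le_syzygies theta_colinear A_div n (stable_le_tensor_coinv MG).
have projM := projective_stable_le projT leM.
have idM : @GRing.linear_for A (module_of MG) M *:%R (fun b => b) by [].
apply: (graded_resolution_of_syzygies A_div (e := mk_linear idM) _ _ _ projM) => //.
by move=> m; exists m.
Qed.

Lemma projective_resolution_of_graded n (M : gradedModule A) :
  graded_projective_resolution n M -> projective_resolution n M.
Proof.
case=> P [d [eps [projP dD epsD ex]]]; exists (fun i => P i), d, eps; split=> // i.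
exact: (projective_of_graded theta_colinear).
Qed.

Lemma gr_gldim_eq : gr_gldim A = gr_pdim B.
Proof.
apply/esym/enat_least_upper => n.
  move=> resB M; apply: enat_least_le; apply: graded_resolution_of_coinv.
  exact: projective_resolution_of_graded.
by move=> allB; apply/enat_leP/(allB B).
Qed.

Lemma gr_pdim_eq : gr_pdim B = pdim B.
Proof.
apply: enat_least_ext => n; split.
  exact: projective_resolution_of_graded.
by move=> resB; apply: graded_resolution_of_coinv.
Qed.

End Dimensions.

End CoinvariantsModule.

Theorem theorem3p22 (k : fieldType) (G : zmodType) (chi : bicharacter G k)
    (H : colourHopfAlgebra chi) (A : comoduleColourAlgebra H)
    (A_comm : colour_commutative chi A)
    (theta : {lrmorphism H -> A})
    (theta_graded : graded_map (@cdeg _ _ H) (@cdeg _ _ A) theta)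
    (theta_colinear : colinear_from_hopf theta)
    (chi_sym : symmetric_bicharacter chi) :
  [/\ colour_simple A -> coinvariants_division_ring A,
      exists (B : gradedModule A) (iota : {additive B -> A}),
        is_coinvariants_module theta iota
    & coinvariants_division_ring A ->
      forall (B : gradedModule A) (iota : {additive B -> A}),
        is_coinvariants_module theta iota ->
        gr_gldim A = gr_pdim B /\ gr_pdim B = pdim B].
Proof.
split.
- exact: division_ring_of_simple.
- exact: coinvariants_module_exists.
- move=> A_div B iota iotaP; split; first exact: gr_gldim_eq iotaP.
  exact: gr_pdim_eq iotaP.
Qed.
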